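(* Let $n\ge 1$ and let $\mathbb{V}=\{V_{1},V_{2},\dots,V_{n}\}$ be a collection of $n$ pairwise independent valuation domains, all with the same quotient field $K$, such that $D=V_{1}\cap V_{2}\cap\cdots\cap V_{n}$ is a GMPD domain. Let $n_1$, $n_2$, $n_3$ be the number of $V\in\mathbb{V}$ whose value group is (isomorphic as an ordered group to) $\mathbb{R}$, $\mathbb{Z}\times\mathbb{Z}$ and $\mathbb{Z}$, respectively. Then $|\mathcal{O}_{ql}(D)|=n_{1}+2n_{2}+n_{3}+1$.
   Context: All rings are commutative unitary integral domains. Two incomparable (under inclusion) valuation domains with the same quotient field are independent if they have no nonzero common prime ideal. Here $\mathbb{Z}\times\mathbb{Z}$ carries the lexicographic order, and $\mathbb{R}$, $\mathbb{Z}$ their usual orders. A ring is quasi-local if it has exactly one maximal ideal (no Noetherian assumption). For an integral domain $D$ with quotient field $K$, an overring of $D$ is a subring of $K$ containing $D$; $\mathcal{O}_{ql}(D)$ is the set of those overrings of $D$ which are quasi-local. $D$ is h-local if each nonzero ideal of $D$ is contained in only finitely many maximal ideals and each nonzero prime ideal is contained in a unique maximal ideal. An MNI ideal of $D$ is an ideal of $D$ which is maximal (under inclusion) among the non-invertible ideals of $D$ (the zero ideal counts as non-invertible). $D$ is an MPD domain if it has a unique MNI ideal $Q$ and every nonzero non-invertible ideal of $D$ can be written as $JQ$ for some invertible ideal $J$ of $D$. $D$ is a GMPD domain (globalized multiplicatively pinched-Dedekind domain) if $D$ is h-local and the localization $D_M$ is an MPD domain for every maximal ideal $M$ of $D$.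 *)

(* Defs.v *)
From HB Require Import structures.
From mathcomp Require Import all_boot all_order all_algebra.
From mathcomp Require Import all_classical reals.

Set Implicit Arguments.
Unset Strict Implicit.
Unset Printing Implicit Defensive.

Import Order.TTheory GRing.Theory Num.Theory.
Local Open Scope classical_set_scope.
Local Open Scope ring_scope.

(* An integral domain is a subring [D : set K] of an ambient field [K]; its
   quotient field is realized inside [K].  Ideals and fractional ideals of [D]
   are subsets of [K] as well.  Predicates below whose argument [D] is meant to
   be a domain are only applied to subrings of [K]. *)

Section Domains.
Variable K : fieldType.
Implicit Types (D A R V W I J M P Q : set K).

Definition subring D : Prop := subring_closed [in D].

Definition quotient_field D : set K :=
  [set x | exists a b, [/\ D a, D b, b != 0 & x = a / b]].

Definition submodule D I : Prop :=
  [/\ I 0,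
      forall x y, I x -> I y -> I (x + y)
    & forall d x, D d -> I x -> I (d * x)].

Definition ideal D I : Prop := submodule D I /\ I `<=` D.

Definition nonzero I : Prop := I <> [set 0].

Definition prime_ideal D P : Prop :=
  [/\ ideal D P, P <> D
    & forall x y, D x -> D y -> P (x * y) -> P x \/ P y].

Definition maximal_ideal D M : Prop :=
  [/\ ideal D M, M <> D
    & forall I, ideal D I -> M `<=` I -> I <> D -> I = M].

Definition quasi_local D : Prop := exists! M, maximal_ideal D M.

Definition overring D R : Prop :=
  [/\ subring R, D `<=` R & R `<=` quotient_field D].

Definition quasi_local_overrings D : set (set K) :=
  [set R | overring D R /\ quasi_local R].

Definition fractional_ideal D J : Prop :=
  [/\ submodule D J, J `<=` quotient_field D
    & exists d, [/\ D d, d != 0 & forall x, J x -> D (d * x)]].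

Definition ideal_mul I J : set K :=
  [set x | exists (m : nat) (a b : 'I_m -> K),
    (forall i, I (a i) /\ J (b i)) /\ x = \sum_(i < m) a i * b i].

Definition invertible_ideal D I : Prop :=
  ideal D I /\ exists J, fractional_ideal D J /\ ideal_mul I J = D.

Definition noninvertible_ideal D I : Prop :=
  ideal D I /\ ~ invertible_ideal D I.

Definition MNI_ideal D Q : Prop :=
  noninvertible_ideal D Q /\
  forall I, noninvertible_ideal D I -> Q `<=` I -> I = Q.

Definition MPD_domain D : Prop :=
  exists Q, [/\ MNI_ideal D Q,
    forall Q', MNI_ideal D Q' -> Q' = Q
  & forall I, noninvertible_ideal D I -> nonzero I ->
      exists J, invertible_ideal D J /\ I = ideal_mul J Q].

Definition localization D M : set K :=
  [set x | exists a s, [/\ D a, D s, ~ M s & x = a / s]].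

Definition h_local D : Prop :=
  (forall I, ideal D I -> nonzero I ->
     finite_set [set M | maximal_ideal D M /\ I `<=` M]) /\
  (forall P, prime_ideal D P -> nonzero P ->
     exists! M, maximal_ideal D M /\ P `<=` M).

Definition GMPD_domain D : Prop :=
  h_local D /\ forall M, maximal_ideal D M -> MPD_domain (localization D M).

(* Valuation domain whose quotient field is the whole of [K]. *)
Definition valuation_domain V : Prop :=
  [/\ subring V, quotient_field V = [set: K]
    & forall x, x != 0 -> V x \/ V x^-1].

Definition independent V W : Prop :=
  [/\ ~ V `<=` W, ~ W `<=` V
    & ~ exists P, [/\ nonzero P, prime_ideal V P & prime_ideal W P]].

Definition unit_group V : set K := [set u | [/\ u != 0, V u & V u^-1]].

(* The value group is [K^* / unit_group V], a set of cosets [x * unit_group V],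
   with the product of cosets and the order for which [V] consists of the
   elements of nonnegative value. *)
Definition unit_coset V (x : K) : set K := [set x * u | u in unit_group V].

Definition value_group V : set (set K) :=
  [set unit_coset V x | x in [set x | x != 0]].

Definition coset_mul (a b : set K) : set K :=
  [set x * y | x in a & y in b].

Definition coset_le V (a b : set K) : Prop :=
  forall x y, a x -> b y -> V (y / x).

(* The value group of [V] is isomorphic, as an ordered group, to the additive
   group [G] ordered by [leG]. *)
Definition value_group_isog V (G : zmodType) (leG : rel G) : Prop :=
  exists f : set K -> G,
    [/\ set_bij (value_group V) [set: G] f,
        forall a b, value_group V a -> value_group V b ->
          f (coset_mul a b) = f a + f b
      & forall a b, value_group V a -> value_group V b ->
          (coset_le V a b <-> leG (f a) (f b))].

End Domains.

(* Lexicographic order, the first coordinate being dominant. *)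
Definition lex_le : rel (int * int) :=
  fun p q => ((p : int *l int) <= (q : int *l int))%O.

(* Main.v *)
Require Import Defs.
From HB Require Import structures.
From mathcomp Require Import all_boot all_order all_algebra.
From mathcomp Require Import all_classical reals.
From mathcomp Require Import ring lra zify.

Set Implicit Arguments.
Unset Strict Implicit.
Unset Printing Implicit Defensive.

Import Order.TTheory GRing.Theory Num.Theory.
Local Open Scope classical_set_scope.
Local Open Scope ring_scope.

(** The quasi-local overrings of [D] turn out to be the valuation rings of [K]
    that contain [D], and these are the rings between some [V i] and [K].

    The intersection [D] is a Pruefer domain: for each [x] in [K] there are [a]
    and [b] with [a + b * x = 1] and [a], [b], [a * x], [b * x] in [D]
    ([cap_prufer]).  In a quasi-local overring one of [a], [b * x] is a unit, so
    the overring contains [x] or its inverse.  Each [V i] is the localization of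
    [D] at the trace of its maximal ideal ([cap_localization]), every proper
    ideal of [D] lies in one of these traces ([cap_ideal_sub]), and hence every
    valuation ring above [D] lies above some [V i] ([cap_valuation_sub]).  Both
    facts on [D] come from a sequence of polynomial expressions modelled on
    Euclid's proof that there are infinitely many primes: its terms are pairwise
    comaximal, so that among [n + 1] of them some one avoids the [n] maximal
    ideals.

    Independence makes the rings strictly below [K] above [V i] and those above
    [V j] disjoint for distinct [i] and [j] ([independent_oversubring]), and it
    makes the traces exactly the maximal ideals of [D] ([center_maximal]).  So
    each [V i] is an MPD domain, and it remains to count, for an MPD valuation
    domain [V], the rings [W] with [V <= W < K]; let [V] be distinct from [K].

    Let [M] be the maximal ideal of [V] and [Q] the MNI ideal; every nonzero
    non-principal ideal is then a multiple of [Q].  If [M] is not principal, then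
    [Q = M]; a nonzero ideal stable under division by a non-unit can be neither
    principal nor a multiple of [M], so the value group is archimedean and embeds
    in the reals (Hoelder), and comparing the ideal of the elements of value
    greater than [r] with a multiple of [M] shows that the embedding is onto
    ([dense_real]).  If [M] is generated by [p], either the powers of [p] are
    cofinal and the value group is [Z] ([uniformizer_int]), or [W = V[1/p]] is
    strictly below [K].  In that case all nonzero [W]-submodules of [V] are
    multiples of [Q], hence of one another, hence principal over [W]; so [W] is a
    discrete valuation ring and the value group is [Z x Z]
    ([uniformizer_int_lex]).  A value group [R] or [Z] leaves only [W = V], and
    [Z x Z] leaves [V] and [V[1/p]]; adding [K] gives the count. *)

(** * Subrings, units and maximal ideals *)

Section Subrings.
Variable K : fieldType.
Implicit Types (D V W I : set K) (x y : K).

Lemma subringP D : subring D <->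
  [/\ D 1, forall x y, D x -> D y -> D (x - y)
    & forall x y, D x -> D y -> D (x * y)].
Proof.
split=> [[h1 hB hM]|[h1 hB hM]]; split.
- by move: h1; rewrite inE.
- by move=> x y Dx Dy; have := hB x y (mem_set Dx) (mem_set Dy); rewrite inE.
- by move=> x y Dx Dy; have := hM x y (mem_set Dx) (mem_set Dy); rewrite inE.
- by rewrite inE.
- by move=> x y; rewrite !inE; apply: hB.
- by move=> x y; rewrite !inE; apply: hM.
Qed.

Section Closure.
Variables (D : set K) (hD : subring D).

Lemma subring1 : D 1. Proof. by case/subringP: hD. Qed.
Lemma subringB x y : D x -> D y -> D (x - y).
Proof. by case/subringP: hD => _ h _; apply: h. Qed.
Lemma subringM x y : D x -> D y -> D (x * y).
Proof. by case/subringP: hD => _ _ h; apply: h. Qed.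
Lemma subring0 : D 0.
Proof. by rewrite -(subrr 1); apply: subringB; apply: subring1. Qed.
Lemma subringN x : D x -> D (- x).
Proof. by move=> Dx; rewrite -sub0r; apply: subringB => //; apply: subring0. Qed.
Lemma subringD x y : D x -> D y -> D (x + y).
Proof. by move=> Dx Dy; rewrite -[y]opprK; apply: subringB => //; apply: subringN. Qed.
Lemma subringX x n : D x -> D (x ^+ n).
Proof.
move=> Dx; elim: n => [|n IH]; first exact: subring1.
by rewrite exprS; apply: subringM.
Qed.
Lemma subring_sum m (F : 'I_m -> K) : (forall i, D (F i)) -> D (\sum_i F i).
Proof.
move=> h; apply: (big_ind D) => //; first exact: subring0.
by move=> x y; apply: subringD.
Qed.

Lemma unit_group1 : unit_group D 1.
Proof. by split; rewrite ?oner_neq0 ?invr1 //; apply: subring1. Qed.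
Lemma unit_groupM x y : unit_group D x -> unit_group D y -> unit_group D (x * y).
Proof.
move=> [x0 Dx Dx'] [y0 Dy Dy']; split; first by rewrite mulf_neq0.
  exact: subringM.
by rewrite invfM; apply: subringM.
Qed.
Lemma unit_groupV x : unit_group D x -> unit_group D x^-1.
Proof. by move=> [x0 Dx Dx']; split; rewrite ?invrK ?invr_eq0. Qed.
Lemma unit_groupX x n : unit_group D x -> unit_group D (x ^+ n).
Proof.
move=> ux; elim: n => [|n IH]; first exact: unit_group1.
by rewrite exprS; apply: unit_groupM.
Qed.
Lemma unit_groupMl x y : D x -> D y -> unit_group D (x * y) -> unit_group D x.
Proof.
move=> Dx Dy [xy0 _ Dxy]; move: xy0; rewrite mulf_eq0 negb_or => /andP[x0 y0].
split=> //; have -> : x^-1 = y * (x * y)^-1 by rewrite invfM mulrCA mulfV ?mulr1.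
exact: subringM.
Qed.

Lemma ideal_full I : ideal D I -> I 1 -> I = D.
Proof.
move=> [[_ _ hI] ID] I1; apply/seteqP; split=> // x Dx.
by rewrite -[x]mulr1; apply: hI.
Qed.

Lemma ideal_proper I : ideal D I -> I <> D -> ~ I 1.
Proof. by move=> hI ID /(ideal_full hI). Qed.

End Closure.

Lemma unit_groupS D W x : D `<=` W -> unit_group D x -> unit_group W x.
Proof. by move=> DW [x0 Dx Dx']; split=> //; apply: DW. Qed.

(** Krull's theorem. *)
Lemma ideal_sub_maximal D I : subring D -> ideal D I -> I <> D ->
  exists M, maximal_ideal D M /\ I `<=` M.
Proof.
move=> hD hI ID.
(* The union of the empty chain is empty, so Zorn's lemma needs [set0] among
   the competitors. *)
pose P A := A = set0 \/ [/\ ideal D A, ~ A 1 & I `<=` A].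
have [F PF totF|A [PA maxA]] := @Zorn_bigcup K P.
  have [F0|] := pselect (forall A, F A -> A = set0).
    left; apply/seteqP; split=> // x [A FA Ax].
    by move: Ax; rewrite (F0 _ FA).
  move=> /existsNP[A0 /not_implyP[FA0 A00]].
  have hA A : F A -> A !=set0 -> [/\ ideal D A, ~ A 1 & I `<=` A].
    by move=> FA [a Aa]; case: (PF _ FA) => // Ae; move: Aa; rewrite Ae.
  have [hA0 A01 IA0] : [/\ ideal D A0, ~ A0 1 & I `<=` A0].
    by case: (PF _ FA0).
  right; split.
  - split; last first.
      by move=> x [A FA Ax]; have [|[_ AD] _ _] := hA _ FA; [exists x|apply: AD].
    split.
    + by exists A0 => //; case: hA0 => -[].
    + move=> x y [A FA Ax] [B FB By].
      case: (totF _ _ FA FB) => [AB|BA].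
        exists B => //; have [|[[_ hB _] _] _ _] := hA _ FB; first by exists y.
        by apply: hB => //; apply: AB.
      exists A => //; have [|[[_ hB _] _] _ _] := hA _ FA; first by exists x.
      by apply: hB => //; apply: BA.
    + move=> d x Dd [A FA Ax]; exists A => //.
      by have [|[[_ _ hB] _] _ _] := hA _ FA; [exists x|apply: hB].
  - by move=> [A FA A1]; have [|_] := hA _ FA; first by exists 1.
  - by move=> x Ix; exists A0 => //; apply: IA0.
have I1 := ideal_proper hI ID.
have A0 : A <> set0.
  move=> A0; apply: (maxA I); last by right; split.
  rewrite A0 properEneq; split=> //.
  by apply/eqP => I0; case: hI => -[]; rewrite -I0.
have {PA}[hA A1 IA] : [/\ ideal D A, ~ A 1 & I `<=` A] by case: PA.
exists A; split; last exact: IA.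
split; first exact: hA.
  by move=> AD; apply: A1; rewrite AD; apply: subring1.
move=> J hJ AJ JD; apply: contrapT => JA; apply: (maxA J).
  by rewrite properEneq; split=> //; apply/eqP => AJe; apply: JA.
by right; split; [exact: hJ|exact: ideal_proper hJ JD|exact: subset_trans AJ].
Qed.

Lemma principal_ideal D a : subring D -> D a -> ideal D [set a * d | d in D].
Proof.
move=> hD Da; split; last by move=> _ [d Dd <-]; apply: subringM.
split.
- by exists 0; rewrite ?mulr0 //; apply: subring0.
- by move=> _ _ [d Dd <-] [e De <-]; exists (d + e); rewrite ?mulrDr //; apply: subringD.
- by move=> c _ Dc [d Dd <-]; exists (c * d); [apply: subringM|rewrite mulrCA].
Qed.

Lemma nonunit_sub_maximal D a : subring D -> D a -> ~ unit_group D a ->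
  exists M, maximal_ideal D M /\ M a.
Proof.
move=> hD Da na.
have hI := principal_ideal hD Da.
have [|M [hM IM]] := ideal_sub_maximal hD hI.
  move=> ID; apply: na.
  have [b Db ab] : [set a * d | d in D] 1 by rewrite ID; apply: subring1.
  apply: (@unit_groupMl _ hD a b) => //.
  by rewrite ab; apply: unit_group1.
exists M; split=> //; apply: IM; exists 1; rewrite ?mulr1 //; exact: subring1.
Qed.

(** If neither summand were a unit, each would lie in a maximal ideal; there is
    only one, and it would contain [1]. *)
Lemma quasi_local_unit D a b : subring D -> quasi_local D -> D a -> D b ->
  a + b = 1 -> unit_group D a \/ unit_group D b.
Proof.
move=> hD [M [_ uM]] Da Db ab1; apply: contrapT => /not_orP[na nb].
have [A [hA Aa]] := nonunit_sub_maximal hD Da na.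
have [B [hB Bb]] := nonunit_sub_maximal hD Db nb.
move: Bb; rewrite -(uM _ hB) (uM _ hA) => Ab.
case: hA => hA AD _; apply: (ideal_proper hA AD); rewrite -ab1.
by case: hA => -[_ hadd _] _; apply: hadd.
Qed.

End Subrings.

(** * Valuation domains *)

Section Valuations.
Variable K : fieldType.
Implicit Types (D V W I : set K) (x y : K).

Definition nonunits V : set K := [set x | V x /\ ~ unit_group V x].

Section Nonunits.
Variables (V : set K) (hV : valuation_domain V).

Lemma valuation_subring : subring V. Proof. by case: hV. Qed.
Let sV := valuation_subring.

Lemma valuation_total x : x != 0 -> V x \/ V x^-1.
Proof. by case: hV => _ _; apply. Qed.

Lemma nonunits0 : nonunits V 0.
Proof. by split; [exact: subring0|move=> []; rewrite eqxx]. Qed.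

Lemma nonunitsMl d x : V d -> nonunits V x -> nonunits V (d * x).
Proof.
move=> Vd [Vx nx]; split; first exact: subringM.
by rewrite mulrC => /(unit_groupMl sV Vx Vd).
Qed.

Lemma nonunitsMr d x : V d -> nonunits V x -> nonunits V (x * d).
Proof. by rewrite mulrC; apply: nonunitsMl. Qed.

Lemma nonunitsV x : ~ V x -> nonunits V x^-1.
Proof.
move=> nVx; have x0 : x != 0.
  by apply: contra_notN nVx => /eqP->; apply: subring0.
by case: (valuation_total x0) => // Vx'; split=> // -[_ _]; rewrite invrK.
Qed.

Lemma nonunits_notV x : nonunits V x -> x != 0 -> ~ V x^-1.
Proof. by move=> [Vx nx] x0 Vx'; apply: nx. Qed.

Lemma nonunits1 : ~ nonunits V 1.
Proof. by move=> [_]; apply; apply: unit_group1. Qed.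

Lemma unit_or_nonunit x : V x -> unit_group V x \/ nonunits V x.
Proof. by move=> Vx; case: (pselect (unit_group V x)); [left|right]. Qed.

(** Of two nonzero elements one divides the other, so their sum is a multiple of
    one of them. *)
Lemma nonunitsD x y : nonunits V x -> nonunits V y -> nonunits V (x + y).
Proof.
have key u v : nonunits V u -> nonunits V v -> u != 0 -> v != 0 ->
    V (v / u) -> nonunits V (u + v).
  move=> hu hv u0 v0 h.
  have -> : u + v = (1 + v / u) * u by rewrite mulrDl mul1r divfK.
  by apply: nonunitsMl => //; apply: subringD => //; apply: subring1.
move=> hx hy; have [->|x0] := eqVneq x 0; first by rewrite add0r.
have [->|y0] := eqVneq y 0; first by rewrite addr0.
have [|h|h] := @valuation_total (y / x); first by rewrite mulf_neq0 ?invr_eq0.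
  exact: key.
by rewrite addrC; apply: key => //; rewrite invf_div in h.
Qed.

Lemma nonunitsB x y : nonunits V x -> nonunits V y -> nonunits V (x - y).
Proof.
move=> hx hy; apply: nonunitsD => //; rewrite -mulN1r; apply: nonunitsMl => //.
by apply: subringN => //; apply: subring1.
Qed.

Lemma nonunits_ideal : ideal V (nonunits V).
Proof.
split; last by move=> x [].
by split; [exact: nonunits0|exact: nonunitsD|exact: nonunitsMl].
Qed.

Lemma ideal_sub_nonunits I : ideal V I -> I <> V -> I `<=` nonunits V.
Proof.
move=> hI IV x Ix; have Vx : V x by case: hI => _; apply.
split=> // -[x0 _ Vx']; apply: (ideal_proper hI IV).
by rewrite -(mulVf x0); case: hI => -[_ _ h] _; apply: h.
Qed.

Lemma nonunits_prime x y : V x -> V y -> nonunits V (x * y) ->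
  nonunits V x \/ nonunits V y.
Proof.
move=> Vx Vy [_ nxy]; apply: contrapT => /not_orP[nx ny]; apply: nxy.
by case: (unit_or_nonunit Vx) (unit_or_nonunit Vy) => // ux [] // uy; apply: unit_groupM.
Qed.

Lemma unit_add_nonunit u x : unit_group V u -> nonunits V x -> unit_group V (u + x).
Proof.
move=> [u0 Vu Vu'] hx.
have [|//|h] := @unit_or_nonunit (u + x).
  by apply: subringD => //; case: hx.
case: (nonunitsB h hx); rewrite addrK => _ []; by split.
Qed.

Lemma nonunitsX x n : nonunits V (x ^+ n) -> V x -> nonunits V x.
Proof.
move=> [_ h] Vx; split=> // ux; apply: h; exact: unit_groupX.
Qed.

Lemma valuation_quasi_local : quasi_local V.
Proof.
exists (nonunits V); split.
  split; first exact: nonunits_ideal.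
    by move=> e; apply: nonunits1; rewrite e; apply: subring1.
  move=> I hI mI IV; apply/seteqP; split=> //; exact: ideal_sub_nonunits.
move=> M [hM MV maxM]; apply: maxM.
- exact: nonunits_ideal.
- exact: ideal_sub_nonunits.
- by move=> e; apply: nonunits1; rewrite e; apply: subring1.
Qed.

Lemma valuation_oversubring W : subring W -> V `<=` W -> valuation_domain W.
Proof.
move=> sW VW; have tot x : x != 0 -> W x \/ W x^-1.
  by move=> /valuation_total[/VW|/VW]; [left|right].
split=> //; apply/seteqP; split=> // x _.
have [->|x0] := eqVneq x 0.
  by exists 0, 1; rewrite mul0r oner_neq0; split=> //; [apply: subring0|apply: subring1].
case: (tot x x0) => h.
  by exists x, 1; rewrite oner_neq0 divr1; split=> //; apply: subring1.
exists 1, x^-1; rewrite invr_eq0 x0 invrK mul1r; split=> //; exact: subring1.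
Qed.

End Nonunits.
End Valuations.

(** * A sequence of pairwise comaximal forms *)

Section Euclid.
Variable K : fieldType.
Implicit Types (D V W I : set K) (p q x y : K).

(** The role of the product of the previous primes in Euclid's proof:
    [euclid p q j] is the product of the [euclid_form p q i] for [i < j].  The
    term [p ^+ (2 ^ j)] makes [euclid_form p q j] homogeneous of degree [2 ^ j]
    in [p] and [q]; with [p = 1] it is a monic polynomial in [q] with constant
    term [1]. *)
Fixpoint euclid p q (j : nat) : K :=
  if j is j'.+1 then euclid p q j' * (p ^+ (2 ^ j') + q * euclid p q j') else 1.

Definition euclid_form p q j : K := p ^+ (2 ^ j) + q * euclid p q j.

Lemma euclidS p q j : euclid p q j.+1 = euclid p q j * euclid_form p q j.
Proof. by []. Qed.

Lemma euclid_in D p q j : subring D -> D p -> D q -> D (euclid p q j).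
Proof.
move=> sD Dp Dq; elim: j => [|j IH]; first exact: subring1.
by apply: subringM => //; apply: subringD => //; [apply: subringX|apply: subringM].
Qed.

Lemma euclid_form_in D p q j : subring D -> D p -> D q -> D (euclid_form p q j).
Proof.
move=> sD Dp Dq; apply: subringD => //; first exact: subringX.
by apply: subringM => //; apply: euclid_in.
Qed.

Section OneValuation.
Variables (V : set K) (hV : valuation_domain V).
Let sV := valuation_subring hV.

Lemma euclid_unit p q j : nonunits V p -> unit_group V q ->
  unit_group V (euclid p q j) /\ unit_group V (euclid_form p q j).
Proof.
move=> np uq.
have key i : unit_group V (euclid p q i) -> unit_group V (euclid_form p q i).
  move=> uh; rewrite /euclid_form addrC; apply: unit_add_nonunit => //.
    exact: unit_groupM.
  have -> : (2 ^ i)%N = (2 ^ i).-1.+1 by rewrite prednK // expn_gt0.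
  rewrite exprS; apply: nonunitsMr => //; apply: subringX => //; by case: np.
suff uh : unit_group V (euclid p q j) by split=> //; apply: key.
elim: j => [|j IH]; first exact: unit_group1.
by rewrite euclidS; apply: unit_groupM => //; apply: key.
Qed.

Lemma euclid_dvd p q i j : V p -> V q -> (i < j)%N ->
  nonunits V (euclid_form p q i) -> nonunits V (euclid p q j).
Proof.
move=> Vp Vq + ni; elim: j => // j IH; rewrite ltnS leq_eqVlt euclidS => /orP[/eqP<-|/IH h].
  by apply: nonunitsMl => //; apply: euclid_in.
by apply: nonunitsMr => //; apply: euclid_form_in.
Qed.

(** [euclid_form p q i] divides [euclid p q j] for [i < j], so a maximal ideal
    that contains both forms contains [p], hence not [q]; but a form is congruent
    to a power of [q] modulo [p]. *)
Lemma euclid_form_coprime p q i j : V p -> V q -> ~ (nonunits V p /\ nonunits V q) ->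
  nonunits V (euclid_form p q i) -> nonunits V (euclid_form p q j) -> i = j.
Proof.
move=> Vp Vq npq; wlog ij : i j / (i < j)%N => [wl ni nj|ni nj].
  by case: (ltngtP i j) => // h; [apply: wl|symmetry; apply: wl].
have nh := euclid_dvd Vp Vq ij ni.
have np : nonunits V p.
  apply: (@nonunitsX _ _ hV _ (2 ^ j)) => //.
  have -> : p ^+ (2 ^ j) = euclid_form p q j - q * euclid p q j by rewrite addrK.
  by apply: nonunitsB => //; apply: nonunitsMl.
have [uq|nq] := unit_or_nonunit Vq; last by case: npq.
by case: ni => _; case; case: (euclid_unit i np uq).
Qed.

(** Where [x] has negative value, the leading term of the polynomial
    [euclid_form 1 x j] dominates.  The invariant that survives the recursion is
    that [euclid 1 x j] is nonzero with its inverse in [V]. *)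
Lemma euclid_form_outside x j : ~ V x ->
  let h := euclid 1 x j in let f := euclid_form 1 x j in
  [/\ f != 0, V f^-1, V (x / f) & V (h / f)].
Proof.
move=> nVx /=.
have ny := nonunitsV hV nVx.
have x0 : x != 0 by apply: contra_notN nVx => /eqP->; apply: subring0.
have key i : euclid 1 x i != 0 -> V (euclid 1 x i)^-1 ->
    let h := euclid 1 x i in let f := euclid_form 1 x i in
    [/\ f != 0, V f^-1, V (x / f) & V (h / f)].
  set h := euclid 1 x i => h0 Vh /=.
  have nyg : nonunits V (x^-1 * h^-1) by apply: nonunitsMr.
  have [u0 Vu Vu'] := unit_add_nonunit hV (unit_group1 sV) nyg.
  set u := 1 + _ in u0 Vu Vu'.
  have fE : euclid_form 1 x i = x * h * u.
    rewrite /euclid_form -/h expr1n /u mulrDr mulr1 addrC; congr (_ + _).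
    by field; rewrite x0 h0.
  rewrite fE; split.
  - by rewrite !mulf_neq0.
  - rewrite !invfM; apply: subringM => //; apply: subringM => //; by case: ny.
  - have -> : x / (x * h * u) = h^-1 * u^-1 by field; rewrite x0 h0 u0.
    exact: subringM.
  - have -> : h / (x * h * u) = x^-1 * u^-1 by field; rewrite x0 h0 u0.
    by apply: subringM => //; case: ny.
suff [h0 Vh] : euclid 1 x j != 0 /\ V (euclid 1 x j)^-1 by apply: key.
elim: j => [|j [h0 Vh]]; first by rewrite invr1 oner_neq0; split=> //; apply: subring1.
rewrite euclidS; have [f0 Vf _ _] := key j h0 Vh.
by rewrite mulf_neq0 // invfM; split=> //; apply: subringM.
Qed.

End OneValuation.
End Euclid.

(** Each of the [n] constraints excludes at most one index, so one of the first
    [n + 1] indices is admissible. *)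
Lemma pigeonhole n (bad : 'I_n -> nat -> Prop) :
  (forall i j k, bad i j -> bad i k -> j = k) ->
  exists j, forall i, ~ bad i j.
Proof.
move=> ub; apply: contrapT => /forallNP h.
have {}h (j : 'I_n.+1) : exists i, bad i j.
  by have /existsNP[i /contrapT bi] := h j; exists i.
have [g hg] := choice h.
suff /leq_card : injective g by rewrite !card_ord ltnn.
by move=> j k gjk; apply/val_inj/(ub (g j)); [apply: hg|rewrite gjk; apply: hg].
Qed.

(** * Rings between a valuation domain and its quotient field *)

Section Overrings.
Variables (K : fieldType) (V W : set K).
Hypotheses (hV : valuation_domain V) (sW : subring W) (VW : V `<=` W).
Let sV := valuation_subring hV.
Let hW := valuation_oversubring hV sW VW.

(** The maximal ideal shrinks when the valuation ring grows. *)
Lemma oversubring_nonunits : nonunits W `<=` nonunits V.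
Proof.
move=> x nx; have [Wx nux] := nx.
have Vx : V x.
  apply: contrapT => nVx; apply: nux; split=> //; first last.
    by apply: VW; case: (nonunitsV hV nVx).
  by apply: contra_notN nVx => /eqP->; apply: subring0.
by split=> // ux; apply: nux; apply: unit_groupS ux.
Qed.

Lemma oversubring_prime : prime_ideal V (nonunits W).
Proof.
split.
- split; last by move=> x /oversubring_nonunits[].
  split; first exact: nonunits0.
    by move=> x y; apply: nonunitsD.
  by move=> d x Vd; apply: nonunitsMl => //; apply: VW.
- move=> e; apply: (nonunits1 hW); rewrite e; exact: subring1.
- by move=> x y Vx Vy; apply: nonunits_prime => //; apply: VW.
Qed.

Lemma nonunits_nonzero : W <> [set: K] -> nonzero (nonunits W).
Proof.
move=> WK e; apply: WK; apply/seteqP; split=> // x _; apply: contrapT => nWx.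
have := nonunitsV hW nWx; rewrite e /= => /eqP; rewrite invr_eq0 => /eqP x0.
by apply: nWx; rewrite x0; apply: subring0.
Qed.

End Overrings.

(** * Finite intersections of valuation domains *)

Section Intersection.
Variables (K : fieldType) (n : nat) (V : 'I_n -> set K).
Hypothesis hV : forall i, valuation_domain (V i).
Let D := \bigcap_i V i.
Let sV i := valuation_subring (hV i).

Lemma capP x : D x <-> forall i, V i x.
Proof. by split=> [h i|h i _]; [apply: h|apply: h]. Qed.

Lemma cap_sub i : D `<=` V i.
Proof. by move=> x /capP. Qed.

Lemma cap_subring : subring D.
Proof.
apply/subringP; split.
- by apply/capP => i; apply: subring1.
- by move=> x y /capP Dx /capP Dy; apply/capP => i; apply: subringB.
- by move=> x y /capP Dx /capP Dy; apply/capP => i; apply: subringM.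
Qed.
Let sD := cap_subring.

(** [D] is a Pruefer domain: [(a, b)] is the inverse of the fractional ideal
    [(1, x)].  With [f = 1 + x * h] a form that is a unit in each [V i]
    containing [x], take [a = f^-1] and [b = h / f]. *)
Lemma cap_prufer (hn : (1 <= n)%N) x :
  exists a b, [/\ a + b * x = 1, D a, D (a * x), D b & D (b * x)].
Proof.
have [|j hj] := @pigeonhole n
    (fun i j => V i x /\ nonunits (V i) (euclid_form 1 x j)).
  move=> i j k [Vx hj] [_ hk].
  apply: (euclid_form_coprime (hV i) _ Vx _ hj hk); first exact: subring1.
  by case=> /(nonunits1 (hV i)).
set h := euclid 1 x j; set f := euclid_form 1 x j.
have key i : [/\ f != 0, V i f^-1, V i (x / f) & V i (h / f)].
  have [Vx|nVx] := pselect (V i x); last exact: euclid_form_outside.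
  have Vh : V i h by apply: euclid_in => //; apply: subring1.
  have [|[f0 _ Vf]|nf] := @unit_or_nonunit _ (V i) f.
  - by apply: euclid_form_in => //; apply: subring1.
  - by split=> //; apply: subringM.
  - by case: (hj i).
have [f0 _ _ _] := key (Ordinal hn).
have e : f^-1 + h / f * x = 1.
  rewrite mulrAC -{1}[f^-1]mul1r -mulrDl (_ : 1 + h * x = f) ?mulfV //.
  by rewrite /f /euclid_form expr1n mulrC.
exists f^-1, (h / f); split=> //.
- by apply/capP => i; case: (key i).
- by apply/capP => i; rewrite mulrC; case: (key i).
- by apply/capP => i; case: (key i).
- have -> : h / f * x = 1 - f^-1 by rewrite -e addrC addKr.
  by apply: (subringB sD); [exact: subring1|apply/capP => i; case: (key i)].
Qed.

(** Two elements of [I] can be replaced by a form in them that is a unit in each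
    [V i] where one of them is; after [n] steps [I] contains an element that is a
    unit in all of them. *)
Lemma cap_comaximal (hn : (1 <= n)%N) I : ideal D I ->
  (forall i, exists2 p, I p & ~ nonunits (V i) p) -> I 1.
Proof.
move=> [[I0 ID IM] sI] hp.
have key m : (m <= n)%N ->
    exists2 d, I d & forall i : 'I_n, (i < m)%N -> unit_group (V i) d.
  elim: m => [|m IH] mn; first by exists 0.
  have [d Id hd] := IH (ltnW mn).
  have [p Ip hpm] := hp (Ordinal mn).
  have Dd := sI _ Id; have Dp := sI _ Ip.
  have [|j hj] := @pigeonhole n (fun i j =>
      ~ (nonunits (V i) d /\ nonunits (V i) p) /\ nonunits (V i) (euclid_form d p j)).
    move=> i j k [ndp hj] [_ hk].
    apply: (euclid_form_coprime (hV i) _ _ ndp hj hk); exact: cap_sub.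
  exists (euclid_form d p j).
    apply: ID.
      have -> : (2 ^ j)%N = (2 ^ j).-1.+1 by rewrite prednK // expn_gt0.
      by rewrite exprSr; apply: IM => //; apply: (subringX sD).
    by rewrite mulrC; apply: IM => //; apply: (euclid_in _ sD).
  move=> i; rewrite ltnS leq_eqVlt => im.
  have [|//|nf] := @unit_or_nonunit _ (V i) (euclid_form d p j).
    by apply: (@cap_sub i); apply: (euclid_form_in _ sD).
  case: (hj i); split=> // -[nd np].
  case/orP: im => [/eqP im|im]; last by case: nd => _; apply; apply: hd.
  by apply: hpm; rewrite (_ : Ordinal mn = i) //; apply: val_inj; rewrite /= im.
have [d Id hd] := key n (leqnn n).
have Dd' : D d^-1 by apply/capP => i; case: (hd i (ltn_ord i)).
have [d0 _ _] := hd (Ordinal hn) hn.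
by rewrite -(mulVf d0); apply: IM.
Qed.

Lemma cap_ideal_sub (hn : (1 <= n)%N) I : ideal D I -> I <> D ->
  exists i, I `<=` nonunits (V i).
Proof.
move=> hI ID; apply: contrapT => /forallNP h; apply: (ideal_proper hI ID).
apply: cap_comaximal => // i; have /existsNP[p /not_implyP[Ip np]] := h i.
by exists p.
Qed.

Definition center i : set K := nonunits (V i) `&` D.

Lemma center_ideal i : ideal D (center i).
Proof.
split; last by move=> x [].
split.
- by split; [apply: nonunits0|apply: (subring0 sD)].
- by move=> x y [nx Dx] [ny Dy]; split; [apply: nonunitsD|apply: (subringD sD)].
- move=> d x Dd [nx Dx]; split; last exact: (subringM sD).
  by apply: nonunitsMl => //; apply: cap_sub.
Qed.

Lemma center_unit i s : D s -> ~ center i s -> unit_group (V i) s.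
Proof.
move=> Ds ns; have [|//|h] := @unit_or_nonunit _ (V i) s; first exact: cap_sub.
by case: ns.
Qed.

(** Write [a + b * x = 1] as in [cap_prufer]; one of [a], [b * x] is a unit of
    [V i], and accordingly [a] or [b] is an admissible denominator for [x]. *)
Lemma cap_localization (hn : (1 <= n)%N) i : localization D (center i) = V i.
Proof.
apply/seteqP; split=> [_ [a [s [Da Ds ns ->]]]|x Vx].
  have [_ _ Vs] := center_unit Ds ns.
  by apply: subringM => //; apply: cap_sub.
have [a [b [e Da Dax Db Dbx]]] := cap_prufer hn x.
have Va := cap_sub i Da; have Vb := cap_sub i Db.
have [[a0 Va' Vai]|na] := unit_or_nonunit Va.
  exists (a * x), a; split=> //; last by rewrite mulrAC mulfV ?mul1r.
  by case=> -[_]; case; split.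
have [ub|nb] := unit_or_nonunit Vb.
  have [b0 _ _] := ub.
  exists (b * x), b; split=> //; last by rewrite mulrAC mulfV ?mul1r.
  by case=> -[_]; case.
case: (nonunits1 (hV i)); rewrite -e; apply: nonunitsD => //.
exact: nonunitsMr.
Qed.

Hypothesis hind : forall i j, i != j -> independent (V i) (V j).

Lemma cap_incomparable i j : V i `<=` V j -> i = j.
Proof.
move=> ij; apply/eqP; apply: contrapT => /negP/hind[] //.
Qed.

(** A proper ideal containing [center i] lies in some [center j]; localizing
    reverses the inclusion, so [V j] is contained in [V i] and [j = i]. *)
Lemma center_maximal (hn : (1 <= n)%N) i : maximal_ideal D (center i).
Proof.
split; first exact: center_ideal.
  move=> e; have [] : center i 1 by rewrite e; apply: (subring1 sD).
  by move=> /(nonunits1 (hV i)).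
move=> I hI iI ID; have [j Ij] := cap_ideal_sub hn hI ID.
have ji : j = i.
  apply: cap_incomparable; rewrite -(cap_localization hn j) -(cap_localization hn i).
  move=> _ [a [s [Da Ds ns ->]]]; exists a, s; split=> // /iI /Ij h.
  by apply: ns.
apply/seteqP; split=> // x Ix; split; first by rewrite -ji; apply: Ij.
by case: hI => _; apply.
Qed.

Lemma cap_quotient_field (hn : (1 <= n)%N) : quotient_field D = [set: K].
Proof.
apply/seteqP; split=> // x _.
have [a [b [e Da Dax Db Dbx]]] := cap_prufer hn x.
have [a0|a0] := eqVneq a 0.
  have b0 : b != 0.
    by apply: contra_eq_neq e => ->; rewrite a0 mul0r addr0 eq_sym oner_neq0.
  exists 1, b; split=> //; first exact: (subring1 sD).
  by rewrite -e a0 add0r mulrAC mulfV ?mul1r.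
by exists (a * x), a; split=> //; rewrite mulrAC mulfV ?mul1r.
Qed.

(** In [a + b * x = 1], either [a] is a unit of [R] and [x = (a * x) / a], or
    [b * x] is one and [x^-1 = b / (b * x)]. *)
Lemma cap_quasi_local_valuation (hn : (1 <= n)%N) R :
  subring R -> D `<=` R -> quasi_local R -> valuation_domain R.
Proof.
move=> sR DR qR.
have tot x : x != 0 -> R x \/ R x^-1.
  move=> x0; have [a [b [e /DR Ra /DR Rax /DR Rb /DR Rbx]]] := cap_prufer hn x.
  have [[a0 _ Ra']|[bx0 _ Rbx']] := quasi_local_unit sR qR Ra Rbx e.
    by left; rewrite (_ : x = a * x * a^-1); [apply: subringM|rewrite mulrAC mulfV ?mul1r].
  right; move: bx0; rewrite mulf_eq0 negb_or => /andP[b0 _].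
  rewrite (_ : x^-1 = b * (b * x)^-1); first exact: subringM.
  by field; rewrite x0 b0.
split=> //; apply/seteqP; split=> // x _.
have [a [b [Da Db b0 ->]]] : quotient_field D x by rewrite cap_quotient_field.
by exists a, b; split=> //; apply: DR.
Qed.

(** The trace on [D] of the maximal ideal of [R] lies in some [center i];
    localizing reverses the inclusion. *)
Lemma cap_valuation_sub (hn : (1 <= n)%N) R :
  valuation_domain R -> D `<=` R -> exists i, V i `<=` R.
Proof.
move=> hR DR; have sR := valuation_subring hR.
have hP : ideal D (nonunits R `&` D).
  split; last by move=> x [].
  split.
  - by split; [apply: nonunits0|apply: (subring0 sD)].
  - by move=> x y [nx Dx] [ny Dy]; split; [apply: nonunitsD|apply: (subringD sD)].
  - by move=> d x Dd [nx Dx]; split; [apply: nonunitsMl => //; apply: DR|apply: (subringM sD)].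
have [|i iP] := cap_ideal_sub hn hP.
  move=> e; have [] : (nonunits R `&` D) 1 by rewrite e; apply: (subring1 sD).
  by move=> /(nonunits1 hR).
exists i; rewrite -(cap_localization hn i) => _ [a [s [Da Ds ns ->]]].
have [|[_ _ Rs]|h] := @unit_or_nonunit _ R s; first exact: DR.
  by apply: subringM => //; apply: DR.
by case: ns; split=> //; apply: iP.
Qed.

Lemma cap_quasi_local_overrings (hn : (1 <= n)%N) R :
  quasi_local_overrings D R <-> subring R /\ exists i, V i `<=` R.
Proof.
split=> [[[sR DR _] qR]|[sR [i iR]]].
  by split=> //; apply: cap_valuation_sub => //; apply: cap_quasi_local_valuation.
split; last by apply: valuation_quasi_local; apply: valuation_oversubring iR.
split=> //; first by move=> x /capP Dx; apply: iR.
by rewrite cap_quotient_field.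
Qed.

(** The maximal ideal of [W] is a common prime ideal of [V i] and [V j]. *)
Lemma independent_oversubring i j W : subring W -> V i `<=` W -> V j `<=` W ->
  W <> [set: K] -> i = j.
Proof.
move=> sW iW jW WK; apply/eqP; apply: contrapT => /negP/hind[_ _]; apply.
exists (nonunits W); split.
- exact: nonunits_nonzero (hV i) sW iW WK.
- exact: oversubring_prime.
- exact: oversubring_prime.
Qed.

End Intersection.

(** * Value groups and valuation maps *)

Section ValueGroup.
Variables (K : fieldType) (V : set K).
Hypothesis hV : valuation_domain V.
Let sV := valuation_subring hV.
Implicit Types x y : K.

Lemma unit_coset_self x : unit_coset V x x.
Proof. by exists 1; rewrite ?mulr1 //; apply: unit_group1. Qed.

Lemma unit_coset_eq x y : x != 0 -> y != 0 ->
  unit_coset V x = unit_coset V y <-> unit_group V (y / x).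
Proof.
move=> x0 y0; split=> [e|u].
  have [u uu <-] : unit_coset V x y by rewrite e; apply: unit_coset_self.
  by rewrite mulrAC mulfV ?mul1r.
apply/seteqP; split=> [_ [v uv <-]|_ [v uv <-]].
  exists (x / y * v); last by field.
  by apply: unit_groupM => //; rewrite -invf_div; apply: unit_groupV.
by exists (y / x * v); [apply: unit_groupM|field].
Qed.

Lemma coset_mulE x y :
  coset_mul (unit_coset V x) (unit_coset V y) = unit_coset V (x * y).
Proof.
apply/seteqP; split=> [_ [_ [u uu <-] [_ [v uv <-] <-]]|_ [u uu <-]].
  by exists (u * v); [apply: unit_groupM|ring].
exists x; first exact: unit_coset_self.
by exists (y * u); [exists u|rewrite mulrA].
Qed.

Lemma coset_leE x y : x != 0 -> y != 0 ->
  coset_le V (unit_coset V x) (unit_coset V y) <-> V (y / x).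
Proof.
move=> x0 y0; split=> [|h _ _ [u [u0 Vu Vu'] <-] [v [v0 Vv Vv'] <-]].
  by apply; apply: unit_coset_self.
have -> : y * v / (x * u) = y / x * (v * u^-1) by field; rewrite x0 u0.
by apply: subringM => //; apply: subringM.
Qed.

(** The valuation itself, with values transported to [G].  It is only meaningful
    on nonzero elements; the value at [0] is arbitrary. *)
Definition valuation_map (G : zmodType) (leG : rel G) (phi : K -> G) : Prop :=
  [/\ forall x y, x != 0 -> y != 0 -> phi (x * y) = phi x + phi y,
      forall g, exists2 x, x != 0 & phi x = g
    & forall x y, x != 0 -> y != 0 -> (V (y / x) <-> leG (phi x) (phi y))].

Lemma value_group_isogP (G : zmodType) (leG : rel G) : antisymmetric leG ->
  value_group_isog V leG <-> exists phi : K -> G, valuation_map leG phi.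
Proof.
move=> asym; split=> [[f [[_ finj fsurj] fM fle]]|[phi [phiM phisurj phile]]].
  have vg x : x != 0 -> value_group V (unit_coset V x) by move=> x0; exists x.
  exists (fun x => f (unit_coset V x)); split.
  - by move=> x y x0 y0; rewrite -coset_mulE fM //; apply: vg.
  - by move=> g; have [_ [x x0 <-] <-] := fsurj g I; exists x.
  - move=> x y x0 y0; rewrite -fle; [|exact: vg..].
    by rewrite coset_leE.
pose f (c : set K) := phi (xget 1 [set x | x != 0 /\ c = unit_coset V x]).
have fE x : x != 0 -> f (unit_coset V x) = phi x.
  move=> x0; rewrite /f; case: xgetP => [y _ [y0 e]|/(_ x)]; last by case.
  have [_ h1 h2] : unit_group V (y / x) by apply/unit_coset_eq.
  apply: asym; apply/andP; split; last by apply/phile.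
  by apply/phile => //; rewrite -invf_div.
exists f; split.
- split=> //.
  + move=> _ _ /set_mem[x x0 <-] /set_mem[y y0 <-]; rewrite !fE // => e.
    have lexx : leG (phi x) (phi x) by apply/phile; rewrite ?divff //; apply: subring1.
    apply/unit_coset_eq => //; split; first by rewrite mulf_neq0 ?invr_eq0.
      by apply/phile; rewrite -?e.
    by rewrite invf_div; apply/phile; rewrite -?e.
  + move=> g _; have [x x0 <-] := phisurj g.
    by exists (unit_coset V x); [exists x|rewrite fE].
- by move=> _ _ [x x0 <-] [y y0 <-]; rewrite coset_mulE !fE ?mulf_neq0 ?phiM.
- move=> _ _ [x x0 <-] [y y0 <-]; rewrite !fE // coset_leE //; exact: phile.
Qed.

(** A group morphism [s] from [G] to the units of [K] that meets each coset of
    the units of [V] determines the valuation: the value of [x] is the unique [a]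
    with [x / s a] a unit. *)
Lemma valuation_map_section (G : zmodType) (leG : rel G) (s : G -> K) :
  antisymmetric leG -> (forall a b, leG a b = leG 0 (b - a)) ->
  (forall a, s a != 0) -> (forall a b, s (a + b) = s a * s b) ->
  (forall a, V (s a) <-> leG 0 a) ->
  (forall x, x != 0 -> exists a, unit_group V (x / s a)) ->
  exists phi : K -> G, valuation_map leG phi.
Proof.
move=> asym leB s0 sD sV' hs.
have s00 : s 0 = 1.
  by apply: (mulfI (s0 0)); rewrite -sD addr0 mulr1.
have sN a : s (- a) = (s a)^-1.
  by apply: (mulfI (s0 a)); rewrite -sD subrr s00 mulfV.
have uniq a b : unit_group V (s a / s b) -> a = b.
  rewrite -sN -sD => -[_ /sV' h1]; rewrite -sN => /sV' h2.
  apply: asym; rewrite leB; apply/andP; split; last by rewrite leB.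
  by rewrite opprB in h2.
have {}hs x : exists a, x != 0 -> unit_group V (x / s a).
  have [->|/hs[a ha]] := eqVneq x 0; first by exists 0.
  by exists a.
have [phi hphi] := choice hs.
have phiE x a : x != 0 -> unit_group V (x / s a) -> phi x = a.
  move=> x0 u; apply: uniq; have -> : s (phi x) / s a = (x / s a) * (x / s (phi x))^-1.
    by field; rewrite x0 !s0.
  by apply: unit_groupM => //; apply: unit_groupV; apply: hphi.
exists phi; split.
- move=> x y x0 y0; apply: phiE; first by rewrite mulf_neq0.
  rewrite sD invfM mulrACA; apply: unit_groupM => //; exact: hphi.
- move=> g; exists (s g); first exact: s0.
  by apply: phiE => //; rewrite mulfV //; apply: unit_group1.
- move=> x y x0 y0; rewrite leB -sV' sD sN.
  have [ux0 Vx Vx'] := hphi _ x0; have [uy0 Vy Vy'] := hphi _ y0.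
  split=> h.
    have -> : s (phi y) / s (phi x) = (y / x) * ((y / s (phi y))^-1 * (x / s (phi x))).
      by field; rewrite x0 y0 !s0.
    by apply: subringM => //; apply: subringM.
  have -> : y / x = (s (phi y) / s (phi x)) * ((x / s (phi x))^-1 * (y / s (phi y))).
    by field; rewrite x0 !s0.
  by apply: subringM => //; apply: subringM.
Qed.

End ValueGroup.

(** * The lexicographic plane *)

Lemma lex_le_asym : antisymmetric lex_le.
Proof.
move=> p q; rewrite /lex_le.
exact: (@Order.POrderTheory.le_anti _ (int *l int)%type).
Qed.

Lemma lex_leE (p q : int * int) :
  lex_le p q = (p.1 <= q.1) && ((q.1 <= p.1) ==> (p.2 <= q.2)).
Proof. by []. Qed.

Lemma lex_leB (p q : int * int) : lex_le p q = lex_le 0 (q - p).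
Proof. by rewrite !lex_leE; case: p q => [a b] [c d] /=; lia. Qed.

Lemma int_cofinal (a b : int) : a < 0 -> a *+ `|b| <= b.
Proof.
move=> a0; rewrite -mulr_natr natz. 
have h : 0 <= `|b|%N%:Z by []. have h2: - `|b|%N%:Z <= b by lia. 
nia.
Qed.

Lemma int_pair_mulrn (a : int * int) n : a *+ n = (a.1 *+ n, a.2 *+ n).
Proof. by elim: n => [|n IH]; rewrite ?mulr0n // !mulrS IH. Qed.

Lemma lex_le_cofinal (a b : int * int) : a.1 < 0 -> exists n, lex_le (a *+ n) b.
Proof.
case: a b => [a1 a2] [b1 b2] /= a0; exists `|b1|.+1%N.
rewrite int_pair_mulrn lex_leE /= mulrS.
have h := int_cofinal b1 a0.
have h' : a1 + a1 *+ `|b1| < b1 by rewrite -[ltRHS]add0r ltr_leD.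
by rewrite ltW // leNgt h'.
Qed.

Lemma lex_le_shift (u : int * int) : 0 <= u.1 -> lex_le 0 (u + (0, `|u.2|%N%:Z)).
Proof.
case: u => a b /= a0; rewrite lex_leE /= addr0 a0 /=; apply/implyP => _.
have : 0 <= b + `|b|%N%:Z by lia.
by [].
Qed.

Lemma lex_le_pred (u : int * int) : 0 <= u.1 -> ~~ lex_le 0 u -> lex_le u (0, -1).
Proof. by case: u => a b; rewrite !lex_leE /=; lia. Qed.

(** * Oversubrings and the value group *)

Section Away.
Variables (K : fieldType) (V : set K) (p : K).
Hypotheses (sV : subring V) (Vp : V p).

(** The localization [V[1/p]]. *)
Definition away : set K := [set x | exists n, V (x * p ^+ n)].

Lemma away_sub : V `<=` away.
Proof. by move=> x Vx; exists 0%N; rewrite expr0 mulr1. Qed.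

Lemma away_subring : subring away.
Proof.
apply/subringP; split.
- by apply: away_sub; apply: subring1.
- move=> x y [m hm] [n hn]; exists (m + n)%N.
  have -> : (x - y) * p ^+ (m + n) = x * p ^+ m * p ^+ n - y * p ^+ n * p ^+ m.
    by rewrite exprD; ring.
  by apply: subringB => //; apply: subringM => //; apply: subringX.
- move=> x y [m hm] [n hn]; exists (m + n)%N.
  by rewrite exprD mulrACA; apply: subringM.
Qed.

Lemma awayV : p != 0 -> away p^-1.
Proof. by move=> p0; exists 1%N; rewrite expr1 mulVf //; apply: subring1. Qed.

End Away.

Section ValuationMap.
Variables (K : fieldType) (V : set K).
Hypothesis hV : valuation_domain V.
Let sV := valuation_subring hV.
Variables (G : zmodType) (leG : rel G) (phi : K -> G).
Hypothesis hphi : valuation_map V leG phi.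
Implicit Types x y : K.

Lemma vmapM x y : x != 0 -> y != 0 -> phi (x * y) = phi x + phi y.
Proof. by case: hphi => h _ _; apply: h. Qed.

Lemma vmap1 : phi 1 = 0.
Proof.
have /eqP := vmapM (oner_neq0 K) (oner_neq0 K).
by rewrite mulr1 -subr_eq0 opprD addNKr oppr_eq0 => /eqP.
Qed.

Lemma vmapX x n : x != 0 -> phi (x ^+ n) = phi x *+ n.
Proof.
move=> x0; elim: n => [|n IH]; first by rewrite expr0 mulr0n vmap1.
by rewrite exprS mulrS vmapM ?expf_neq0 // IH.
Qed.

Lemma vmapV x : x != 0 -> phi x^-1 = - phi x.
Proof.
move=> x0; have x0' : x^-1 != 0 by rewrite invr_eq0.
by apply: (addrI (phi x)); rewrite -vmapM // mulfV // vmap1 subrr.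
Qed.

Lemma vmap_le x y : x != 0 -> y != 0 -> V (y / x) <-> leG (phi x) (phi y).
Proof. by case: hphi => _ _ h; apply: h. Qed.

Lemma vmap_ge0 x : x != 0 -> V x <-> leG 0 (phi x).
Proof. by move=> x0; rewrite -vmap1 -vmap_le ?oner_neq0 // divr1. Qed.

Lemma vmap_surj g : exists2 x, x != 0 & phi x = g.
Proof. by case: hphi. Qed.

Lemma vmap_proper g : ~~ leG 0 g -> V <> [set: K].
Proof.
move=> ng e; have [x x0 xg] := vmap_surj g.
have : V x by rewrite e.
by move=> /(vmap_ge0 x0); rewrite xg; apply/negP.
Qed.

(** If the multiples of the value of [w] are cofinal downwards, each [x] is a
    multiple of a power of [w] by an element of [V]. *)
Lemma cofinal_oversubring W w : subring W -> V `<=` W -> W w -> w != 0 ->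
  (forall b, exists n, leG (phi w *+ n) b) -> W = [set: K].
Proof.
move=> sW VW Ww w0 cof; apply/seteqP; split=> // x _.
have [->|x0] := eqVneq x 0; first exact: subring0.
have [n hn] := cof (phi x).
have wn0 : w ^+ n != 0 by rewrite expf_neq0.
rewrite -[x](divfK wn0); apply: subringM => //; last exact: subringX.
by apply/VW/vmap_le => //; rewrite vmapX.
Qed.

End ValuationMap.

Definition proper_oversubring (K : fieldType) (V W : set K) : Prop :=
  [/\ subring W, V `<=` W & W <> [set: K]].

Section OversubringsFromGroup.
Variables (K : fieldType) (V : set K).
Hypothesis hV : valuation_domain V.
Let sV := valuation_subring hV.

Lemma archimedean_oversubrings (G : zmodType) (leG : rel G) (phi : K -> G) (g : G) :
  valuation_map V leG phi -> ~~ leG 0 g ->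
  (forall a b, ~~ leG 0 a -> exists n, leG (a *+ n) b) ->
  forall W, proper_oversubring V W <-> W = V.
Proof.
move=> hphi ng arch W; split=> [[sW VW WK]|->]; last first.
  by split=> //; apply: vmap_proper hphi _ ng.
apply/seteqP; split=> // w Ww; apply: contrapT => nVw; apply: WK.
have w0 : w != 0 by apply: contra_notN nVw => /eqP->; apply: subring0.
apply: (cofinal_oversubring hphi sW VW Ww w0) => b; apply: arch.
by apply/negP => /(vmap_ge0 hphi w0).
Qed.

Lemma real_oversubrings (R : realType) : value_group_isog V (<=%R : rel R) ->
  forall W, proper_oversubring V W <-> W = V.
Proof.
move=> /(value_group_isogP hV (@le_anti _ R))[phi hphi].
apply: (archimedean_oversubrings hphi (g := -1)); first by rewrite -ltNge ltrN10.
move=> a b; rewrite -ltNge => a0.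
have [n hn] : exists n : nat, `|b / a| <= n%:R.
  by exists (Num.bound `|b / a|); apply: ltW; apply: archi_boundP.
exists n; have a0' : a < 0 by [].
have := le_trans (ler_norm _) hn; rewrite ler_ndivrMr // -mulr_natr mulrC; lra.
Qed.

Lemma int_oversubrings : value_group_isog V (<=%R : rel int) ->
  forall W, proper_oversubring V W <-> W = V.
Proof.
move=> /(value_group_isogP hV (@le_anti _ int))[phi hphi].
apply: (archimedean_oversubrings hphi (g := -1)) => // a b a0.
by exists `|b|%N; apply: int_cofinal; rewrite ltNge.
Qed.

(** The second ring is [V[1/p]] for [p] of value [(0, 1)], that is the ring of
    elements whose first coordinate is nonnegative. *)
Lemma int_lex_oversubrings : value_group_isog V lex_le ->
  exists2 V1, V1 <> V &
    forall W, proper_oversubring V W <-> W = V \/ W = V1.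
Proof.
move=> /(value_group_isogP hV lex_le_asym)[phi hphi].
have [p p0 hp] := vmap_surj hphi (0, 1).
have Vp : V p by apply/(vmap_ge0 hphi p0); rewrite hp.
have hpn n : phi (p ^+ n) = (0, n%:Z).
  by rewrite (vmapX hphi) // hp int_pair_mulrn /= mul0rn natz.
have awayP x : x != 0 -> away V p x <-> 0 <= (phi x).1.
  move=> x0; have pn0 n : p ^+ n != 0 by rewrite expf_neq0.
  split=> [[n /(vmap_ge0 hphi (mulf_neq0 x0 (pn0 n)))]|h].
    by rewrite (vmapM hphi) // hpn lex_leE /= addr0 => /andP[].
  exists `|(phi x).2|%N; apply/(vmap_ge0 hphi (mulf_neq0 x0 (pn0 _))).
  by rewrite (vmapM hphi) // hpn; apply: lex_le_shift.
(* A negative first coordinate is cofinal downwards. *)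
have lt0_full W w : subring W -> V `<=` W -> W w -> w != 0 -> (phi w).1 < 0 ->
    W = [set: K].
  move=> sW VW Ww w0 h; apply: (cofinal_oversubring hphi sW VW Ww w0) => b.
  exact: lex_le_cofinal.
have nVp : ~ V p^-1.
  by move/(vmap_ge0 hphi _); rewrite invr_eq0 (vmapV hphi) // hp => /(_ p0).
exists (away V p).
  by move=> e; apply: nVp; rewrite -e; apply: awayV.
move=> W; split=> [[sW VW WK]|]; last first.
  case=> ->; split=> //.
  - by apply: (vmap_proper hphi (g := (-1, 0))).
  - exact: away_subring.
  - exact: away_sub.
  - have [x x0 hx] := vmap_surj hphi (-1, 0) => e.
    have : away V p x by rewrite e.
    by move/(awayP x x0); rewrite hx.
have [WV|] := pselect (W `<=` V); first by left; apply/seteqP.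
move=> /existsNP[w /not_implyP[Ww nVw]]; right.
have w0 : w != 0 by apply: contra_notN nVw => /eqP->; apply: subring0.
have ge0 x : W x -> x != 0 -> 0 <= (phi x).1.
  by move=> Wx x0; rewrite leNgt; apply/negP => h; apply: WK; apply: (lt0_full W x).
(* [w] is outside [V] with first coordinate [0], so its value is at most that
   of [p^-1]. *)
have Wp' : W p^-1.
  have p0' : p^-1 != 0 by rewrite invr_eq0.
  rewrite -[p^-1](divfK w0); apply: subringM => //; apply/VW/(vmap_le hphi) => //.
  have := ge0 w Ww w0; have : ~~ lex_le 0 (phi w) by apply/negP => /(vmap_ge0 hphi w0).
  by rewrite (vmapV hphi) // hp => h1 h2; apply: lex_le_pred.
apply/seteqP; split=> x.
  have [->|x0] := eqVneq x 0; first by move=> _; apply: subring0; apply: away_subring.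
  by move=> Wx; apply/awayP => //; apply: ge0.
move=> [n Vx]; have pn0 : p ^+ n != 0 by rewrite expf_neq0.
rewrite -[x](mulfK pn0) -exprVn; apply: subringM => //; [exact: VW|exact: subringX].
Qed.

(** [Z] has a least positive element and [R] has none. *)
Lemma real_int_exclusive (R : realType) : value_group_isog V (<=%R : rel R) ->
  ~ value_group_isog V (<=%R : rel int).
Proof.
move=> /(value_group_isogP hV (@le_anti _ R))[phi hphi].
move=> /(value_group_isogP hV (@le_anti _ int))[psi hpsi].
have [x x0 hx] := vmap_surj hpsi 1.
have [y y0 hy] := vmap_surj hphi (phi x / 2).
have same u v : u != 0 -> v != 0 -> (psi u < psi v) = (phi u < phi v).
  move=> u0 v0; rewrite !ltNge; congr (~~ _).
  by apply/idP/idP => h; [apply/(vmap_le hphi)|apply/(vmap_le hpsi)] => //;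
    [apply/(vmap_le hpsi)|apply/(vmap_le hphi)].
have x_gt0 : 0 < phi x.
  by rewrite -(vmap1 hphi) -same ?oner_neq0 // (vmap1 hpsi) hx.
have : 0 < psi y.
  by rewrite -(vmap1 hpsi) same ?oner_neq0 // (vmap1 hphi) hy divr_gt0.
have : psi y < 1 by rewrite -hx same // hy; lra.
lia.
Qed.

End OversubringsFromGroup.

(** * Ideals of an MPD valuation domain *)

Section Scaling.
Variable K : fieldType.
Implicit Types (V I J Q : set K) (a x : K).

Definition scale a I : set K := [set a * x | x in I].

Lemma scaleM a b I : scale a (scale b I) = scale (a * b) I.
Proof.
apply/seteqP; split=> [_ [_ [x Ix <-] <-]|_ [x Ix <-]].
  by exists x; rewrite ?mulrA.
by exists (b * x); [exists x|rewrite mulrA].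
Qed.

Lemma scaleK a I : a != 0 -> scale a^-1 (scale a I) = I.
Proof.
move=> a0; rewrite scaleM mulVf //; apply/seteqP; split=> [_ [x Ix <-]|x Ix].
  by rewrite mul1r.
by exists x; rewrite ?mul1r.
Qed.

Lemma ideal_mul_mem I J x y : I x -> J y -> ideal_mul I J (x * y).
Proof.
move=> Ix Jy; exists 1%N, (fun=> x), (fun=> y); split=> //.
by rewrite big_ord1.
Qed.

End Scaling.

Section PinchedValuation.
Variables (K : fieldType) (V : set K).
Hypothesis hV : valuation_domain V.
Let sV := valuation_subring hV.
Implicit Types (I J Q : set K) (a x y : K).

Definition principal I : Prop := exists a, [/\ V a, a != 0 & I = scale a V].

Lemma scale_self a I : I 1 -> scale a I a.
Proof. by move=> I1; exists 1; rewrite ?mulr1. Qed.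

(** Among the products whose sum is [1] one, say [a i * b i], is a unit, and then
    [a i] generates [I]. *)
Lemma invertible_principal I : invertible_ideal V I -> principal I.
Proof.
move=> [[[I0 ID IM] IV] [J [_ IJ]]].
have [m [a [b [hab e]]]] : ideal_mul I J 1 by rewrite IJ; apply: subring1.
have Vab x y : I x -> J y -> V (x * y).
  by move=> Ix Jy; rewrite -IJ; apply: ideal_mul_mem.
have [i [ab0 _ Vab']] : exists i, unit_group V (a i * b i).
  apply: contrapT => /forallNP h; apply: (nonunits1 hV); rewrite e.
  apply: (big_ind (nonunits V)); first exact: nonunits0.
    by move=> x y; apply: nonunitsD.
  by move=> i _; have [ai bi] := hab i; split; [apply: Vab|apply: h].
have [ai bi] := hab i; move: ab0; rewrite mulf_eq0 negb_or => /andP[a0 b0].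
exists (a i); split=> //; first exact: IV.
apply/seteqP; split=> [x Ix|_ [v Vv <-]]; last by rewrite mulrC; apply: IM.
exists (x * b i * (a i * b i)^-1); last by field; rewrite a0 b0.
by apply: subringM => //; apply: Vab.
Qed.

Lemma principal_invertible I : principal I -> invertible_ideal V I.
Proof.
move=> [a [Va a0 ->]]; split; first exact: principal_ideal.
have a0' : a^-1 != 0 by rewrite invr_eq0.
exists (scale a^-1 V); split.
  split.
  - split.
    + by exists 0; rewrite ?mulr0 //; apply: subring0.
    + by move=> _ _ [x Vx <-] [y Vy <-]; exists (x + y); rewrite ?mulrDr //; apply: subringD.
    + by move=> d _ Vd [x Vx <-]; exists (d * x); [apply: subringM|rewrite mulrCA].
  - by case: hV => _ ->.
  - by exists a; split=> // _ [x Vx <-]; rewrite mulrA mulfV ?mul1r.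
apply/seteqP; split=> [_ [m [b [c [h ->]]]]|x Vx].
  apply: subring_sum => // i; have [[v Vv <-] [w Vw <-]] := h i.
  have -> : a * v * (a^-1 * w) = v * w by field.
  exact: subringM.
have -> : x = a * (a^-1 * x) by rewrite mulrA mulfV ?mul1r.
by apply: ideal_mul_mem; [exact: (scale_self a (subring1 sV))|exists x].
Qed.

Lemma ideal_mul_principal a Q : ideal V Q -> ideal_mul (scale a V) Q = scale a Q.
Proof.
move=> [[Q0 QD QM] _]; apply/seteqP; split=> [_ [m [b [c [h ->]]]]|_ [x Qx <-]].
  apply: (big_ind (scale a Q)).
  - by exists 0; rewrite ?mulr0.
  - by move=> _ _ [x Qx <-] [y Qy <-]; exists (x + y); [apply: QD|rewrite mulrDr].
  - move=> i _; have [[v Vv <-] Qc] := h i.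
    by exists (v * c i); [apply: QM|rewrite mulrA].
by apply: ideal_mul_mem => //; exact: (scale_self a (subring1 sV)).
Qed.

(** What the MPD property says of a valuation domain, where the invertible ideals
    are the nonzero principal ones. *)
Definition pinched Q : Prop :=
  [/\ ideal V Q, ~ principal Q,
      forall I, ideal V I -> ~ principal I -> Q `<=` I -> I = Q
    & forall I, ideal V I -> nonzero I -> ~ principal I ->
        exists2 a, a != 0 & I = scale a Q].

Lemma MPD_pinched : MPD_domain V -> exists Q, pinched Q.
Proof.
move=> [Q [[[hQ nQ] maxQ] _ hJ]]; exists Q; split=> //.
- by move/principal_invertible.
- by move=> I hI nI; apply: maxQ; split=> // /invertible_principal.
- move=> I hI I0 nI; have [|//|J [/invertible_principal[a [Va a0 ->]] ->]] := hJ I.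
    by split=> // /invertible_principal.
  by exists a => //; apply: ideal_mul_principal.
Qed.

(** The maximal ideal, when it is not invertible, is the only candidate. *)
Lemma pinched_nonunits Q : pinched Q -> ~ principal (nonunits V) -> Q = nonunits V.
Proof.
move=> [hQ nQ maxQ _] nm; symmetry; apply: maxQ => //; first exact: nonunits_ideal.
apply: ideal_sub_nonunits => // QV; apply: nQ; exists 1.
split; [exact: subring1|exact: oner_neq0|].
by rewrite QV; apply/seteqP; split=> [x Vx|_ [x Vx <-]];
  [exists x; rewrite ?mul1r|rewrite mul1r].
Qed.

Lemma nonunit_exprz u k : nonunits V u -> u != 0 -> V (u ^ k) <-> 0 <= k.
Proof.
move=> nu u0; split=> [|].
  case: k => [//|n]; rewrite NegzE -exprnN => Vu'.
  exfalso; case: nu => Vu; apply; split=> //.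
  have un0 : u ^+ n != 0 by rewrite expf_neq0.
  have -> : u^-1 = u ^+ n * u ^- n.+1 by rewrite exprSr; field; rewrite un0 u0.
  by apply: subringM => //; apply: subringX.
by case: k => [n|//] _; apply: subringX => //; case: nu.
Qed.

End PinchedValuation.


Lemma int_floor (P : int -> Prop) (k0 k1 : int) : (forall k, P (k + 1) -> P k) ->
  P k0 -> ~ P k1 -> exists a, P a /\ ~ P (a + 1).
Proof.
move=> down Pk0 nPk1; apply: contrapT => /forallNP h.
have up k : P k -> P (k + 1).
  by move=> Pk; apply: contrapT => nPk; apply: (h k).
(* [P] propagates from [k0] to every integer. *)
have updown (n : nat) : P (k0 + n%:Z) /\ P (k0 - n%:Z).
  elim: n => [|n [IH1 IH2]].
    by rewrite addr0.
  split.
    by rewrite (_ : k0 + n.+1%:Z = k0 + n%:Z + 1); [apply: up|lia].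
  by apply: down; rewrite (_ : k0 - n.+1%:Z + 1 = k0 - n%:Z); last lia.
apply: nPk1; have [h1 h2] := updown `|k1 - k0|%N.
have [e|e] : k1 = k0 + `|k1 - k0|%N%:Z \/ k1 = k0 - `|k1 - k0|%N%:Z by lia.
  by rewrite e.
by rewrite e.
Qed.

Lemma exprz_floor (K : fieldType) (V : set K) (u x : K) (m n : nat) : u != 0 ->
  (forall y, V y -> V (y * u)) -> V (x * u ^+ m) -> ~ V (x / u ^+ n) ->
  exists a : int, V (x / u ^ a) /\ ~ V (x / u ^ (a + 1)).
Proof.
move=> u0 Vu Vm nVn.
apply: (@int_floor (fun k => V (x / u ^ k)) (- m%:Z) n%:Z) => //.
  move=> k /Vu; rewrite expfzDr // expr1z invfM mulrA mulfVK //.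
by rewrite -exprnN invrK.
Qed.

(** * Principal maximal ideal *)

Section Discrete.
Variables (K : fieldType) (V : set K) (p : K).
Hypotheses (hV : valuation_domain V) (Vp : V p) (p0 : p != 0).
Hypothesis hp : nonunits V = scale p V.
Let sV := valuation_subring hV.
Implicit Types (I J Q : set K) (a x y : K).

Lemma uniformizer_nonunit : nonunits V p.
Proof. by rewrite hp; apply: scale_self; apply: subring1. Qed.
Let np := uniformizer_nonunit.

Lemma uniformizer_floor x m n : x != 0 -> V (x * p ^+ m) -> ~ V (x / p ^+ n) ->
  exists a : int, unit_group V (x / p ^ a).
Proof.
move=> x0 hm hn; have [|a [Va nVa]] := exprz_floor p0 _ hm hn.
  by move=> y Vy; apply: subringM.
exists a; have [//|] := unit_or_nonunit Va.
rewrite hp => -[v Vv e]; case: nVa.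
by rewrite expfzDr // expr1z invfM mulrA -e mulrAC mulfV ?mul1r.
Qed.

(** When no nonzero element is divisible by all powers of [p], each is a unit
    times a power of [p]. *)
Lemma uniformizer_int : (forall x, x != 0 -> exists n, ~ V (x / p ^+ n)) ->
  value_group_isog V (<=%R : rel int).
Proof.
move=> arch; apply/(value_group_isogP hV (@le_anti _ int)).
apply: (valuation_map_section hV (s := fun k : int => p ^ k)).
- exact: le_anti.
- by move=> a b; rewrite subr_ge0.
- by move=> a; apply: expfz_neq0.
- by move=> a b; apply: expfzDr.
- by move=> a; apply: nonunit_exprz.
move=> x x0; have [n hn] := arch x x0.
have [m hm] : exists m, ~ V (x^-1 / p ^+ m) by apply: arch; rewrite invr_eq0.
have Vm : V (x * p ^+ m).
  apply: contrapT => h; apply: hm; rewrite -invfM.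
  by case: (nonunitsV hV h).
exact: uniformizer_floor Vm hn.
Qed.

Section RankTwo.
Variables (Q : set K) (t : K).
Hypotheses (hQ : pinched V Q) (t0 : t != 0) (ht : forall n, V (t / p ^+ n)).

Let W := away V p.
Let VW : V `<=` W := away_sub p.
Let sW : subring W := away_subring sV Vp.
Let hW : valuation_domain W := valuation_oversubring hV sW VW.
Let Wp' : W p^-1 := awayV sV p0.

Lemma away_exprz k : W (p ^ k).
Proof.
case: k => n; first by apply: VW; apply: subringX.
by rewrite NegzE -exprnN -exprVn; apply: subringX.
Qed.

(** A nonzero submodule over [V[1/p]] is not principal over [V], because it is
    stable under division by [p]. *)
Lemma away_submodule I : submodule W I -> I `<=` V -> nonzero I ->
  exists2 a, a != 0 & I = scale a Q.
Proof.
move=> [I0 ID IM] IV In0; case: hQ => _ _ _; apply=> //.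
  by split=> //; split=> // d x /VW; apply: IM.
move=> [c [Vc c0 Ie]].
have Ic : I c by rewrite Ie; apply: scale_self; apply: subring1.
have : I (p^-1 * c) by apply: IM.
rewrite Ie mulrC => -[v Vv /(mulfI c0) e].
by apply: (nonunits_notV np p0); rewrite -e.
Qed.

(** An element divisible by all powers of [p] stays a non-unit after [p] has been
    inverted. *)
Lemma infinitesimal_nonunit : nonunits W t.
Proof.
split; first by apply: VW; have := ht 0; rewrite expr0 divr1.
move=> [_ _ [n Vn]]; apply: (nonunits_notV np p0).
have -> : p^-1 = t^-1 * p ^+ n * (t / p ^+ n.+1).
  by rewrite exprS; field; rewrite t0 p0 expf_neq0.
by apply: subringM.
Qed.

(** The maximal ideal of [W] and the principal ideal [t W] are both multiples of
    [Q], so [Q] is principal over [W], and with it every nonzero [W]-submodule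
    of [V]. *)
Lemma away_principal : exists g, [/\ g != 0, nonunits W = scale g W &
  forall I, submodule W I -> I `<=` V -> nonzero I -> exists2 a, a != 0 & I = scale a W].
Proof.
have nt := infinitesimal_nonunit.
have PV : nonunits W `<=` V by move=> x /(oversubring_nonunits hV VW)[].
have [|//||a a0 Pa] := @away_submodule (nonunits W).
- by split; [apply: nonunits0|apply: nonunitsD|apply: nonunitsMl].
- by move=> e; move: nt; rewrite e /= => /eqP; rewrite (negbTE t0).
have [|||b b0 tb] := @away_submodule (scale t W).
- have [[h0 hD hM] _] := principal_ideal sW (VW (PV _ nt)).
  by split.
- by move=> _ [w Ww <-]; apply: PV; apply: nonunitsMr.
- move=> e; have : scale t W t by apply: scale_self; apply: subring1.
  by rewrite e /= => /eqP; rewrite (negbTE t0).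
have QE : Q = scale (b^-1 * t) W by rewrite -scaleM tb scaleK.
have bt0 : b^-1 * t != 0 by rewrite mulf_neq0 ?invr_eq0.
exists (a * (b^-1 * t)); split.
- by rewrite mulf_neq0.
- by rewrite Pa {1}QE scaleM.
- move=> I hI IV /(away_submodule hI IV)[c c0 ->].
  exists (c * (b^-1 * t)); first by rewrite mulf_neq0.
  by rewrite {1}QE scaleM.
Qed.

(** [W] is a discrete valuation ring with uniformizer [g] and [p] generates the
    maximal ideal of the image of [V] in its residue field, so each [x] is a unit
    times [g ^ k * p ^ l]. *)
Lemma uniformizer_int_lex : value_group_isog V lex_le.
Proof.
have [g [g0 gP hI]] := away_principal.
have ng : nonunits W g by rewrite gP; apply: scale_self; apply: subring1.
have PV : nonunits W `<=` V by move=> x /(oversubring_nonunits hV VW)[].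
have arch x : x != 0 -> exists n, ~ W (x / g ^+ n).
  move=> x0; apply: contrapT => /forallNP h.
  pose I := [set y | forall n, W (y / g ^+ n)].
  have Ig y : I y -> I (y / g).
    by move=> Iy n; have := Iy n.+1; rewrite exprS invfM mulrA.
  have [|||c c0 Ie] := hI I.
  - split=> [n|y z Iy Iz n|d y Wd Iy n].
    + by rewrite mul0r; apply: subring0.
    + by rewrite mulrDl; apply: subringD.
    + by rewrite -mulrA; apply: subringM.
  - move=> y Iy; apply: PV; rewrite gP; exists (y / g).
      by have := Iy 1%N; rewrite expr1.
    by rewrite mulrC divfK.
  - move=> e; have : I x by move=> n; apply: contrapT; apply: h.
    by rewrite e /= => /eqP; rewrite (negbTE x0).
  have Ic : I c by rewrite Ie; apply: scale_self; apply: subring1.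
  have := Ig c Ic; rewrite Ie => -[w Ww /(mulfI c0) e].
  by apply: (nonunits_notV ng g0); rewrite -e.
apply/(value_group_isogP hV lex_le_asym).
apply: (valuation_map_section hV (s := fun k : int * int => g ^ k.1 * p ^ k.2)).
- exact: lex_le_asym.
- exact: lex_leB.
- by move=> a; rewrite mulf_neq0 ?expfz_neq0.
- by move=> a b /=; rewrite !expfzDr // mulrACA.
- move=> [k l] /=; rewrite lex_leE /=; split=> [Vs|].
    have k0 : 0 <= k.
      apply/(nonunit_exprz hW _ ng g0).
      have -> : g ^ k = g ^ k * p ^ l * p ^ (- l).
        by rewrite -mulrA -expfzDr // subrr mulr1.
      by apply: subringM => //; [apply: VW|apply: away_exprz].
    rewrite k0 /=; apply/implyP => k0'; have k00 : k = 0 by lia.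
    apply/(nonunit_exprz hV _ np p0).
    by move: Vs; rewrite k00 mul1r.
  case: k => [[|k]|k] //=.
    by rewrite mul1r => /(nonunit_exprz hV _ np p0).
  move=> _; apply: PV; apply: nonunitsMr => //; first exact: away_exprz.
  rewrite -exprnP exprS; apply: nonunitsMr => //; apply: subringX => //.
  by case: ng.
move=> x x0; have [n hn] := arch x x0.
have [m hm] : exists m, ~ W (x^-1 / g ^+ m) by apply: arch; rewrite invr_eq0.
have Wm : W (x * g ^+ m).
  apply: contrapT => h; apply: hm; rewrite -invfM.
  by case: (nonunitsV hW h).
have [|k [Wk nWk]] := exprz_floor g0 _ Wm hn.
  by move=> y Wy; apply: subringM => //; case: ng.
have [[w0 _ [b Vb]]|] := unit_or_nonunit Wk; last first.
  rewrite gP => -[v Vv e]; case: nWk.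
  by rewrite expfzDr // expr1z invfM mulrA -e mulrAC mulfV ?mul1r.
have [a Va] := Wk.
(* The inverse of the unit [x / g ^ k] of [W] bounds its divisibility by
   powers of [p]. *)
have nVb : ~ V (x / g ^ k / p ^+ b.+1).
  move=> h; apply: (nonunits_notV np p0).
  have -> : p^-1 = (x / g ^ k)^-1 * p ^+ b * (x / g ^ k / p ^+ b.+1).
    by rewrite exprS; move: w0; set w := x / _ => w0; field; rewrite w0 p0 expf_neq0.
  exact: subringM.
have [l ul] := uniformizer_floor w0 Va nVb.
by exists (k, l); rewrite /= invfM mulrA.
Qed.

End RankTwo.
End Discrete.

(** * The archimedean case: Hoelder's embedding *)

Section Holder.
Variables (R : realType) (K : fieldType) (V : set K) (u : K).
Hypotheses (hV : valuation_domain V) (nu : nonunits V u) (u0 : u != 0).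
Hypothesis arch : forall x y, nonunits V x -> x != 0 -> y != 0 ->
  exists n, ~ V (y / x ^+ n).
Let sV := valuation_subring hV.
Let uz k : u ^ k != 0 := expfz_neq0 k u0.

(** The elements outside a valuation ring are closed under products: their
    inverses are the nonzero non-units. *)
Lemma notVM x y : ~ V x -> ~ V y -> ~ V (x * y).
Proof.
move=> nx ny.
have x0 : x != 0 by apply: contra_notN nx => /eqP->; apply: subring0.
have y0 : y != 0 by apply: contra_notN ny => /eqP->; apply: subring0.
have [Vy' _] := nonunitsV hV ny.
have := nonunitsMr hV Vy' (nonunitsV hV nx).
rewrite -invfM => /nonunits_notV h; rewrite -[x * y]invrK; apply: h.
by rewrite invr_eq0 mulf_neq0.
Qed.

Lemma ratio_floor x : x != 0 ->
  exists a : int, V (x / u ^ a) /\ ~ V (x / u ^ (a + 1)).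
Proof.
move=> x0; have [n hn] := arch nu u0 x0.
have [m hm] : exists m, ~ V (x^-1 / u ^+ m) by apply: arch; rewrite ?invr_eq0.
apply: (@exprz_floor _ V u x m n) => //.
  by move=> y Vy; apply: subringM => //; case: nu.
by apply: contrapT => h; apply: hm; rewrite -invfM; case: (nonunitsV hV h).
Qed.

(** [p / q <= v x / v u < p' / q'] in terms of the valuation [v], with the
    denominators cleared. *)
Lemma ratio_lt x (p p' : int) (q q' : nat) : x != 0 ->
  V (x ^+ q / u ^ p) -> ~ V (x ^+ q' / u ^ p') -> p * q'%:Z <= p' * q%:Z.
Proof.
move=> x0 h /(nonunitsV hV)[h' _]; rewrite -subr_ge0.
apply/(nonunit_exprz hV _ nu u0).
have -> : u ^ (p' * q - p * q') = (x ^+ q / u ^ p) ^+ q' * (x ^+ q' / u ^ p')^-1 ^+ q.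
  rewrite invf_div !exprMn !exprVn -!exprM mulnC expfzDr // -invr_expz.
  rewrite !exprnP !exprz_exp mulrACA mulrC -mulrA.
  have xq : x ^ (q' * q)%N != 0 by apply: expfz_neq0.
  by field; rewrite xq uz.
by apply: subringM => //; apply: subringX.
Qed.

(** The quotient of the value of [x] by the value of [u], as a Dedekind cut. *)
Definition value_ratio x : R :=
  sup [set r : R | exists (p : int) (q : nat),
    [/\ (0 < q)%N, V (x ^+ q / u ^ p) & r = p%:~R / q%:R]].

Lemma ratio_lower x (p : int) (q : nat) : x != 0 -> (0 < q)%N ->
  V (x ^+ q / u ^ p) -> p%:~R <= q%:R * value_ratio x.
Proof.
move=> x0 q0 h; have q0' : 0 < q%:R :> R by rewrite ltr0n.
rewrite mulrC -ler_pdivrMr //; apply: ub_le_sup; last by exists p, q.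
have [a [_ ha]] := ratio_floor x0.
exists (a + 1)%:~R => _ [p' [q' [q'0 h' ->]]].
rewrite ler_pdivrMr ?ltr0n //.
have := ratio_lt (q' := 1) x0 h' ha; rewrite mulr1.
by rewrite -(ler_int R) rmorphM.
Qed.

Lemma ratio_upper x (p : int) (q : nat) : x != 0 -> (0 < q)%N ->
  ~ V (x ^+ q / u ^ p) -> q%:R * value_ratio x <= p%:~R.
Proof.
move=> x0 q0 h; have q0' : 0 < q%:R :> R by rewrite ltr0n.
rewrite mulrC -ler_pdivlMr //; apply: ge_sup.
  have [a [ha _]] := ratio_floor x0.
  by exists (a%:~R / 1%:R), a, 1%N.
move=> _ [p' [q' [q'0 h' ->]]].
rewrite ler_pdivrMr ?ltr0n // mulrAC ler_pdivlMr //.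
have := ratio_lt x0 h' h.
by rewrite -(ler_int R) !rmorphM.
Qed.

(** Knowing the value of [x ^+ N] up to one multiple of the value of [u]
    determines [value_ratio x] within [1 / N]. *)
Lemma ratio_approx x N (a : int) : x != 0 -> (0 < N)%N ->
  V (x ^+ N / u ^ a) -> ~ V (x ^+ N / u ^ (a + 1)) ->
  a%:~R <= N%:R * value_ratio x <= a%:~R + 1.
Proof.
move=> x0 N0 h1 h2; rewrite ratio_lower //=.
by have := ratio_upper x0 N0 h2; rewrite rmorphD.
Qed.

(** The integer parts of [N] times each ratio show that [N] times the defect of
    additivity is at most [2] for every [N]. *)
Lemma ratioM x y : x != 0 -> y != 0 -> value_ratio (x * y) = value_ratio x + value_ratio y.
Proof.
move=> x0 y0; set d := value_ratio (x * y) - (value_ratio x + value_ratio y).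
have bound N : (0 < N)%N -> N%:R * `|d| <= 2.
  move=> N0.
  have [|a [ha ha']] := @ratio_floor (x ^+ N); first by rewrite expf_neq0.
  have [|b [hb hb']] := @ratio_floor (y ^+ N); first by rewrite expf_neq0.
  have /andP[ax xa] := ratio_approx x0 N0 ha ha'.
  have /andP[by_ yb] := ratio_approx y0 N0 hb hb'.
  have xy0 : x * y != 0 by rewrite mulf_neq0.
  have lo : (a + b)%:~R <= N%:R * value_ratio (x * y).
    apply: ratio_lower => //; rewrite exprMn expfzDr // invfM mulrACA.
    exact: subringM.
  have up : N%:R * value_ratio (x * y) <= (a + 1 + (b + 1))%:~R.
    apply: ratio_upper => //; rewrite exprMn expfzDr // invfM mulrACA.
    exact: notVM.
  have -> : N%:R * `|d| = `|N%:R * value_ratio (x * y) -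
      (N%:R * value_ratio x + N%:R * value_ratio y)|.
    by rewrite -mulrDr -mulrBr normrM (ger0_norm (ler0n _ _)).
  move: lo up; rewrite !rmorphD /= => lo up.
  rewrite ler_norml; lra.
apply/eqP; rewrite -subr_eq0 -/d -normr_le0 leNgt; apply/negP => d0.
have := archi_boundP (divr_ge0 (ler0n R 2) (ltW d0)).
set N := Num.bound _ => hN.
have N0 : (0 < N)%N by rewrite lt0n; apply: contraTneq hN => ->; rewrite -leNgt divr_ge0 // ltW.
by have := bound N N0; rewrite leNgt -ltr_pdivrMr // hN.
Qed.

(** If [x] is not in [V], some power of [x^-1] exceeds [u], so the ratio of [x]
    is bounded away from [0]. *)
Lemma ratio_ge0 x : x != 0 -> V x <-> 0 <= value_ratio x.
Proof.
move=> x0; split=> [Vx|].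
  by have := @ratio_lower x 0 1 x0 isT; rewrite divr1 mul1r; apply.
apply: contraPP => nVx; have nx := nonunitsV hV nVx.
have x0' : x^-1 != 0 by rewrite invr_eq0.
have [n hn] := arch nx x0' u0.
have n0 : (0 < n)%N.
  by case: n hn => //; rewrite expr0 divr1 => -[]; case: nu.
have := @ratio_upper x (-1) n x0 n0; rewrite exprN1 invrK mulrC.
rewrite exprVn invrK in hn => /(_ hn) h.
apply/negP; rewrite -ltNge -(pmulr_rlt0 _ (_ : 0 < n%:R)) ?ltr0n //.
by apply: le_lt_trans h _; rewrite rmorphN /= ltrN10.
Qed.

Lemma ratio_u : 0 < value_ratio u.
Proof.
have u0' : u^-1 != 0 by rewrite invr_eq0.
rewrite ltNge; apply/negP => h.
have e : value_ratio 1 = 0.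
  by have /eqP := ratioM (oner_neq0 K) (oner_neq0 K); rewrite mulr1 addrC -subr_eq subrr eq_sym => /eqP.
have : value_ratio u + value_ratio u^-1 = 0 by rewrite -ratioM // mulfV.
move=> e'; apply: (nonunits_notV nu u0); apply/ratio_ge0 => //; lra.
Qed.

End Holder.

(** * Non-principal maximal ideal *)

Section Dense.
Variables (R : realType) (K : fieldType) (V Q : set K).
Hypotheses (hV : valuation_domain V) (VK : V <> [set: K]).
Hypotheses (hQ : pinched V Q) (hm : ~ principal V (nonunits V)).
Let sV := valuation_subring hV.

Lemma proper_nonunit : exists2 u, nonunits V u & u != 0.
Proof.
have /existsNP[x nVx] : ~ forall x, V x.
  by move=> h; apply: VK; apply/seteqP; split.
exists x^-1; first exact: nonunitsV.
by rewrite invr_eq0; apply: contra_notN nVx => /eqP->; apply: subring0.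
Qed.

Lemma dense_ideal I : ideal V I -> nonzero I -> ~ principal V I ->
  exists2 a, a != 0 & I = scale a (nonunits V).
Proof.
have QE := pinched_nonunits hV hQ hm.
by case: hQ; rewrite QE => _ _ _; apply.
Qed.

(** The elements divisible by all powers of [x] form an ideal stable under
    division by [x].  If it were [c V], then [x^-1] would be in [V]; if it were
    [c] times the maximal ideal, then [c * x], hence [c], would lie in it. *)
Lemma dense_archimedean x y : nonunits V x -> x != 0 -> y != 0 ->
  exists n, ~ V (y / x ^+ n).
Proof.
move=> nx x0 y0; apply: contrapT => /forallNP h.
pose I := [set y | forall n, V (y / x ^+ n)].
have Ix z : I z -> I (z / x).
  by move=> Iz n; have := Iz n.+1; rewrite exprS invfM mulrA.
have hI : ideal V I.
  split; last by move=> z /(_ 0%N); rewrite expr0 divr1.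
  split=> [n|z t Iz It n|d z Vd Iz n].
  - by rewrite mul0r; apply: subring0.
  - by rewrite mulrDl; apply: subringD.
  - by rewrite -mulrA; apply: subringM.
have I0 : nonzero I.
  move=> e; have : I y by move=> n; apply: contrapT; apply: h.
  by rewrite e /= => /eqP; rewrite (negbTE y0).
have [[c [Vc c0 Ie]]|nI] := pselect (principal V I).
  have Ic : I c by rewrite Ie; apply: scale_self; apply: subring1.
  have := Ix c Ic; rewrite Ie => -[w Vw /(mulfI c0) e].
  by apply: (nonunits_notV nx x0); rewrite -e.
have [c c0 Ie] := dense_ideal hI I0 nI.
have : I (c * x) by rewrite Ie; exists x.
move=> /Ix; rewrite mulfK // Ie => -[w nw e].
by apply: (nonunits1 hV); rewrite (_ : 1 = w) //; apply: (mulfI c0); rewrite e mulr1.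
Qed.

(** The elements of value greater than a given [r >= 0] form an ideal, which is
    not principal because there are arbitrarily small positive values; so it is
    the ideal of the elements of value greater than [phi c] for some [c], and
    [phi c = r]. *)
Lemma dense_real : value_group_isog V (<=%R : rel R).
Proof.
have [u nu u0] := proper_nonunit.
pose phi := @value_ratio R K V u.
have phiM x y : x != 0 -> y != 0 -> phi (x * y) = phi x + phi y.
  exact: ratioM hV nu u0 dense_archimedean _ _.
have phi_ge0 x : x != 0 -> V x <-> 0 <= phi x.
  exact: ratio_ge0 hV nu u0 dense_archimedean _.
have phi_u : 0 < phi u := ratio_u R hV nu u0 dense_archimedean.
have phi1 : phi 1 = 0.
  have /eqP := phiM 1 1 (oner_neq0 K) (oner_neq0 K).
  by rewrite mulr1 addrC -subr_eq subrr eq_sym => /eqP.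
have phiV x : x != 0 -> phi x^-1 = - phi x.
  move=> x0; apply: (addrI (phi x)).
  by rewrite -phiM ?invr_eq0 // mulfV // subrr.
have phiX x n : x != 0 -> phi (x ^+ n) = n%:R * phi x.
  move=> x0; elim: n => [|n IH]; first by rewrite expr0 phi1 mul0r.
  by rewrite exprS phiM ?expf_neq0 // IH -[n.+1]add1n natrD mulrDl mul1r.
have phi_gt0 x : x != 0 -> nonunits V x <-> 0 < phi x.
  move=> x0; split=> [nx|h].
    rewrite ltNge -oppr_ge0 -phiV //; apply/negP => /phi_ge0.
    by rewrite invr_eq0 => /(_ x0); apply: nonunits_notV.
  split; first by apply/phi_ge0 => //; apply: ltW.
  move=> [_ _ /phi_ge0]; rewrite invr_eq0 => /(_ x0).
  by rewrite phiV // oppr_ge0 leNgt h.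
have small (e : R) : 0 < e -> exists x, [/\ x != 0, 0 < phi x & phi x < e].
  move=> e0.
  (* Of the two factors of a non-trivial factorization of [x] one has at most
     half the value of [x]. *)
  have halve n : exists x, [/\ x != 0, 0 < phi x & phi x * 2 ^+ n <= phi u].
    elim: n => [|n [x [x0 hx hxn]]]; first by exists u; rewrite expr0 mulr1.
    have Vx : V x by apply/phi_ge0 => //; apply: ltW.
    have nx : nonunits V x by apply/phi_gt0.
    have /existsNP[y /not_implyP[ny nVyx]] : ~ (nonunits V `<=` scale x V).
      move=> h; apply: hm; exists x; split=> //; apply/seteqP; split=> // _ [v Vv <-].
      exact: nonunitsMr.
    have y0 : y != 0.
      apply: contra_notN nVyx => /eqP->; exists 0; rewrite ?mulr0 //; exact: subring0.
    have yx0 : y / x != 0 by rewrite mulf_neq0 ?invr_eq0.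
    have xy0 : x / y != 0 by rewrite mulf_neq0 ?invr_eq0.
    have nxy : nonunits V (x / y).
      rewrite -invf_div; apply: nonunitsV => // Vyx; apply: nVyx.
      by exists (y / x); rewrite // mulrC divfK.
    have py : 0 < phi y by apply/phi_gt0.
    have pxy : 0 < phi (x / y) by apply/phi_gt0.
    have e2 : phi x = phi y + phi (x / y) by rewrite -phiM // mulrC divfK.
    have pw : 0 < 2 ^+ n :> R by rewrite exprn_gt0.
    have [le|lt] := lerP (phi y) (phi (x / y)).
      exists y; split=> //; apply: le_trans hxn; rewrite exprS mulrA ler_pM2r //; lra.
    exists (x / y); split=> //; apply: le_trans hxn; rewrite exprS mulrA ler_pM2r //; lra.
  have h0 := divr_ge0 (ltW phi_u) (ltW e0).
  have := archi_boundP h0; set n := Num.bound _ => hn.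
  have [x [x0 hx hxn]] := halve n; exists x; split=> //.
  have pw : 0 < 2 ^+ n :> R by rewrite exprn_gt0.
  have lt2 : phi u / e < 2 ^+ n.
    by apply: lt_trans hn _; rewrite -natrX ltr_nat ltn_expl.
  rewrite -(ltr_pM2r pw); apply: le_lt_trans hxn _.
  by rewrite mulrC -ltr_pdivrMr.
have surj0 (r : R) : 0 <= r -> exists2 x, x != 0 & phi x = r.
  move=> r0; pose I := [set x | x = 0 \/ (x != 0 /\ r < phi x)].
  have inI x : x != 0 -> I x -> r < phi x.
    by move=> x0 [x00|[]//]; rewrite x00 eqxx in x0.
  have IM d x : V d -> I x -> I (d * x).
    have [->|d0] := eqVneq d 0; first by rewrite mul0r; left.
    move=> Vd [->|[x0 hx]]; first by rewrite mulr0; left.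
    right; rewrite mulf_neq0 // phiM //; split=> //.
    by have /phi_ge0 : V d by []; move/(_ d0) => h; lra.
  have IV : I `<=` V.
    move=> x [->|[x0 hx]]; first exact: subring0.
    by apply/phi_ge0 => //; lra.
  have hI : ideal V I.
    split=> //; split; [by left| |exact: IM].
    have key x y : I x -> I y -> x != 0 -> y != 0 -> V (y / x) -> I (x + y).
      move=> Ix Iy x0 y0 h; have -> : x + y = (1 + y / x) * x by rewrite mulrDl mul1r divfK.
      by apply: IM => //; apply: subringD => //; apply: subring1.
    move=> x y Ix Iy; have [->|x0] := eqVneq x 0; first by rewrite add0r.
    have [->|y0] := eqVneq y 0; first by rewrite addr0.
    have [|h|h] := @valuation_total _ V hV (y / x); first by rewrite mulf_neq0 ?invr_eq0.
      exact: key.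
    by rewrite addrC; apply: key => //; rewrite invf_div in h.
  have In0 : nonzero I.
    have h0 := divr_ge0 r0 (ltW phi_u).
    have := archi_boundP h0; set n := Num.bound _ => hn e.
    have un0 : u ^+ n != 0 by rewrite expf_neq0.
    have : I (u ^+ n) by right; split=> //; rewrite phiX // -ltr_pdivrMr.
    by rewrite e /= => /eqP; rewrite (negbTE un0).
  (* Below an element of value greater than [r] there is a smaller one, so
     the cut at [r] has no least element above it. *)
  have drop c : c != 0 -> r < phi c -> exists e, [/\ e != 0, nonunits V e & I (c / e)].
    move=> c0 hc; have [|e [e0 he1 he2]] := small (phi c - r); first by rewrite subr_gt0.
    exists e; split=> //; first by apply/phi_gt0.
    right; split; first by rewrite mulf_neq0 ?invr_eq0.
    by rewrite phiM ?invr_eq0 // phiV //; lra.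
  have nI : ~ principal V I.
    move=> [c [Vc c0 Ie]].
    have hc : r < phi c by apply: inI => //; rewrite Ie; apply: scale_self; apply: subring1.
    have [e [e0 ne]] := drop c c0 hc; rewrite Ie => -[v Vv /(mulfI c0) ve].
    by apply: (nonunits_notV ne e0); rewrite -ve.
  have [c c0 Ie] := dense_ideal hI In0 nI; exists c => //.
  apply/eqP; rewrite eq_le; apply/andP; split; rewrite leNgt; apply/negP => hc.
    have [e [e0 ne]] := drop c c0 hc; rewrite Ie => -[v [Vv _] /(mulfI c0) ve].
    by apply: (nonunits_notV ne e0); rewrite -ve.
  have [|e [e0 he1 he2]] := small (r - phi c); first by rewrite subr_gt0.
  have : I (c * e) by rewrite Ie; exists e => //; apply/phi_gt0.
  by move=> /inI; rewrite mulf_neq0 // phiM // => /(_ isT) h; lra.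
apply/(value_group_isogP hV (@le_anti _ R)); exists phi; split=> //.
  move=> r; have h0 := divr_ge0 (normr_ge0 r) (ltW phi_u).
  have := archi_boundP h0; set n := Num.bound _.
  rewrite ltr_pdivrMr // => hn.
  have [|x x0 hx] := surj0 (r + n%:R * phi u).
    by have := ler_norm (- r); rewrite normrN; lra.
  have un0 : u ^+ n != 0 by rewrite expf_neq0.
  exists (x / u ^+ n); first by rewrite mulf_neq0 ?invr_eq0.
  by rewrite phiM ?invr_eq0 // phiV // phiX // hx addrK.
move=> x y x0 y0; rewrite phi_ge0 ?mulf_neq0 ?invr_eq0 //.
by rewrite phiM ?invr_eq0 // phiV // subr_ge0.
Qed.

End Dense.

Lemma MPD_value_group (R : realType) (K : fieldType) (V : set K) :
  valuation_domain V -> MPD_domain V -> V <> [set: K] ->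
  [\/ value_group_isog V (<=%R : rel R), value_group_isog V lex_le
    | value_group_isog V (<=%R : rel int)].
Proof.
move=> hV /(MPD_pinched hV)[Q hQ] VK.
have [[p [Vp p0 hp]]|hm] := pselect (principal V (nonunits V)); last first.
  by apply: Or31; apply: dense_real hQ hm.
have [h|/existsNP[t /not_implyP[t0 /forallNP ht]]] :=
    pselect (forall x, x != 0 -> exists n, ~ V (x / p ^+ n)).
  by apply: Or33; apply: uniformizer_int hp h.
by apply: Or32; apply: (uniformizer_int_lex hV Vp p0 hp hQ t0) => n; apply: contrapT.
Qed.

(** * Counting *)

(** The contribution of [V] to [n1 + 2 * n2 + n3]. *)
Definition oversubring_number (R : realType) (K : fieldType) (V : set K) : nat :=
  `[< value_group_isog V (<=%R : rel R) >] + 2 * `[< value_group_isog V lex_le >] +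
  `[< value_group_isog V (<=%R : rel int) >].

(** The three value groups exclude one another: [Z x Z] has two rings below [K],
    [R] and [Z] only one, and they are distinguished by density.  All three are
    excluded when [V = K], which has no such ring. *)
Lemma MPD_oversubrings (R : realType) (K : fieldType) (V : set K) :
  valuation_domain V -> MPD_domain V ->
  exists w : 'I_(oversubring_number R V) -> set K,
    injective w /\ forall W, proper_oversubring V W <-> exists k, w k = W.
Proof.
move=> hV hM; rewrite /oversubring_number.
have self : (forall W, proper_oversubring V W <-> W = V) -> V <> [set: K].
  by move=> h; have [] : proper_oversubring V V by apply/h.
have lexN : value_group_isog V lex_le -> ~ (forall W, proper_oversubring V W <-> W = V).
  move=> /(int_lex_oversubrings hV)[V1 V1V h] h'.
  by apply: V1V; apply/h'/h; right.
have one : (forall W, proper_oversubring V W <-> W = V) ->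
    exists w : 'I_1 -> set K,
      injective w /\ forall W, proper_oversubring V W <-> exists k, w k = W.
  move=> h; exists (fun=> V); split; first by move=> i j _; rewrite !ord1.
  by move=> W; rewrite h; split=> [->|[_ <-]] //; exists ord0.
have realN := real_int_exclusive (R := R) hV.
have [VK|VK] := pselect (V = [set: K]).
  have nR : ~ value_group_isog V (<=%R : rel R).
    by move=> h; exact: self (real_oversubrings hV h) VK.
  have nZ : ~ value_group_isog V (<=%R : rel int).
    by move=> h; exact: self (int_oversubrings hV h) VK.
  have nZZ : ~ value_group_isog V lex_le.
    move=> /(int_lex_oversubrings hV)[V1 _ h].
    by have [] : proper_oversubring V V by apply/h; left.
  rewrite (asboolF nR) (asboolF nZ) (asboolF nZZ).
  exists (fun=> V); split; first by case.
  move=> W; split=> [[_ VW []]|[[]]//].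
  by apply/seteqP; split=> // x _; apply: VW; rewrite VK.
case: (MPD_value_group R hV hM VK) => h.
- have h' := real_oversubrings hV h.
  have nZZ : ~ value_group_isog V lex_le by move=> /lexN; apply.
  by rewrite (asboolT h) (asboolF (realN h)) (asboolF nZZ); apply: one.
- have [V1 V1V h'] := int_lex_oversubrings hV h.
  have nR : ~ value_group_isog V (<=%R : rel R).
    by move=> hr; apply: lexN h (real_oversubrings hV hr).
  have nZ : ~ value_group_isog V (<=%R : rel int).
    by move=> hz; apply: lexN h (int_oversubrings hV hz).
  rewrite (asboolT h) (asboolF nR) (asboolF nZ).
  exists (fun k : 'I_2 => if k == 0%N :> nat then V else V1); split.
    move=> [[|[|//]] ?] [[|[|//]] ?] //= e; try exact: val_inj; by case: V1V.
  move=> W; rewrite h'; split=> [[]->|[k <-]].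
  + by exists ord0.
  + by exists ord_max.
  by case: ifP => _; [left|right].
- have h' := int_oversubrings hV h.
  have nZZ : ~ value_group_isog V lex_le by move=> /lexN; apply.
  have nR : ~ value_group_isog V (<=%R : rel R) by move/realN.
  by rewrite (asboolT h) (asboolF nR) (asboolF nZZ); apply: one.
Qed.

Theorem theorem7 (R : realType) (K : fieldType) (n : nat)
    (V : 'I_n -> set K) (D : set K) (n1 n2 n3 : nat)
    (hn : (1 <= n)%N)
    (hV : forall i, valuation_domain (V i))
    (hind : forall i j, i != j -> independent (V i) (V j))
    (hD : D = \bigcap_i V i)
    (hGMPD : GMPD_domain D)
    (hn1 : n1 = #|[pred i | `[< value_group_isog (V i) (<=%R : rel R) >]]|)
    (hn2 : n2 = #|[pred i | `[< value_group_isog (V i) lex_le >]]|)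
    (hn3 : n3 = #|[pred i | `[< value_group_isog (V i) (<=%R : rel int) >]]|) :
  (quasi_local_overrings D #= `I_(n1 + 2 * n2 + n3 + 1))%card.
Proof.
have hM i : MPD_domain (V i).
  rewrite -(cap_localization hV hn i); have [_] := hGMPD; rewrite hD; apply.
  exact: center_maximal.
pose c i := oversubring_number R (V i).
have hw i := cid (MPD_oversubrings R (hV i) (hM i)).
pose w i : 'I_(c i) -> set K := sval (hw i).
have w_inj i : injective (w i) by case: (svalP (hw i)).
have wP i W : proper_oversubring (V i) W <-> exists k, w i k = W.
  by case: (svalP (hw i)) => _; apply.
(* [None] stands for [K], the other elements for the rings strictly below [K]. *)
pose S := option {i : 'I_n & 'I_(c i)}.
pose f (s : S) : set K := if s is Some p then w (tag p) (tagged p) else [set: K].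
have wi i k : proper_oversubring (V i) (w i k) by apply/wP; exists k.
have f_inj : injective f.
  move=> [[i k]|] [[j l]|] //= e.
  - have [sW iW WK] := wi i k; have [_ jW _] := wi j l; rewrite -e in jW.
    have ij : i = j by apply: independent_oversubring hV hind _ _ _ sW iW jW WK.
    by move: l e {jW}; rewrite -ij => l /w_inj->.
  - by have [_ _ []] := wi i k.
  - by have [_ _ []] := wi j l.
have fE : quasi_local_overrings D = f @` [set: S].
  rewrite hD; apply/seteqP; split=> [W /(cap_quasi_local_overrings hV hn)[sW [i iW]]|_ [s _ <-]].
    have [->|WK] := pselect (W = [set: K]); first by exists None.
    have /wP[k <-] : proper_oversubring (V i) W by [].
    by exists (Some (Tagged (fun i => 'I_(c i)) k)).
  apply/(cap_quasi_local_overrings hV hn); case: s => [[i k]|] /=.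
    by have [sW iW _] := wi i k; split=> //; exists i.
  by split; [apply/subringP|exists (Ordinal hn)].
have -> : (n1 + 2 * n2 + n3 + 1)%N = #|{: S}|.
  rewrite card_option card_tagged sumnE big_map big_enum /= addn1; congr _.+1.
  under eq_bigr => i _ do rewrite card_ord /c /oversubring_number.
  have count (P : 'I_n -> Prop) : #|[pred i | `[< P i >]]| = (\sum_i `[< P i >])%N.
    by rewrite -sum1_card big_mkcond; apply: eq_bigr => i _; rewrite inE; case: asboolP.
  by rewrite hn1 hn2 hn3 !count big_distrr -!big_split.
rewrite fE; apply: card_eq_trans (inj_card_eq _) _; first by move=> s t _ _; apply: f_inj.
rewrite card_eq_sym; apply: card_eq_trans card_II _.
have /inj_card_eq : {in [set: 'I_#|{: S}|] &, injective (@enum_val S predT)}.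
  by move=> s t _ _; apply: enum_val_inj.
rewrite card_eq_sym (_ : _ @` _ = setT) //; apply/seteqP; split=> // s _.
by exists (enum_rank s); rewrite ?enum_rankK.
Qed.
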